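(* Let ${\cal P}$ be a graph property and let $f$ be a function. Suppose there is an algorithm that, for any graph $H$ on a fixed vertex set of size $n$ with $m$ edges, computes a sparse strong certificate of $H$ for ${\cal P}$ using space ${\cal O}(m)$ and time $f(n,m)$. Then there is a one-pass semi-streaming algorithm that, given a graph stream of any graph $G$ on these $n$ vertices, computes a sparse strong certificate of $G$ for ${\cal P}$ with per-edge processing time $T=f(n,{\cal O}(n))/n$.
   Context: Graphs are undirected, without loops, possibly with multiple edges. For a graph $G$ on vertex set $V$, a strong certificate of $G$ for ${\cal P}$ is a graph $G'$ on $V$ such that for every graph $H$ on $V$, $G\cup H$ has ${\cal P}$ if and only if $G'\cup H$ has ${\cal P}$. A certificate is sparse if it has ${\cal O}(n)$ edges. A graph stream of $G$ is the sequence of its edges in arbitrary order. A one-pass semi-streaming algorithm reads the stream once, sequentially, using at most ${\cal O}(n\cdot\mathrm{polylog}\,n)$ bits of memory; its per-edge processing time $T$ is the minimum time that must be allowed between the arrival of two consecutive edges of the stream (worst case).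
   Formalization: The per-edge time is proved as T = O(f(n,O(n))/n + 1): at least one elementary step per edge is allowed, since for sublinear f (e.g. constant f for ''has at least two edges'') the bound f(n,O(n))/n falls below one step and the claim fails; if f(n,m) ≥ m the extra term is absorbed. *)

(* Defs.v *)
From mathcomp Require Import all_boot.
Set Implicit Arguments.
Unset Strict Implicit.
Unset Printing Implicit Defensive.

(** * Multigraphs and strong certificates *)

Definition edge (n : nat) := {e : {set 'I_n} | #|e| == 2}.

(* A loopless multigraph on the vertex set 'I_n: the multiplicity of each
   unordered pair of distinct vertices. *)
Definition mgraph (n : nat) := {ffun edge n -> nat}.

Definition num_edges n (G : mgraph n) : nat := \sum_(e : edge n) G e.

(* Union of graphs with multiple edges: edges are distinct objects, so
   multiplicities add up. *)
Definition gunion n (G H : mgraph n) : mgraph n := [ffun e => G e + H e].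

Definition strong_certificate (P : forall n, mgraph n -> Prop) n
    (G G' : mgraph n) : Prop :=
  forall H : mgraph n, P n (gunion G H) <-> P n (gunion G' H).

(* l lists the edges of G, each as often as its multiplicity, in any order and
   with any choice of the order of the two endpoints. *)
Definition edge_list n (G : mgraph n) (l : seq ('I_n * 'I_n)) : Prop :=
  all (fun p => p.1 != p.2) l /\
  forall e : edge n, count (fun p => [set p.1; p.2] == val e) l = G e.

(** * Random access machines with an input port *)

Inductive binop := Add | Sub | Mul | Div.

Definition eval_binop (o : binop) : nat -> nat -> nat :=
  match o with Add => addn | Sub => subn | Mul => muln | Div => divn end.

(* L: labels (finite control), X: registers, A: arrays. *)
Inductive instr (L X A : Type) :=
| Const of X & nat & L             (* d := k *)
| Op of binop & X & X & X & L      (* d := x op y *)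
| Fetch of X & A & X & L           (* d := a[x] *)
| Store of A & X & X & L           (* a[x] := y *)
| Branch of X & X & L & L          (* if x < y then goto l1 else goto l2 *)
| Recv of X & X & L & L & L        (* poll the port: an edge (stored in the two
                                      registers) / nothing / end of stream *)
| Halt.
Arguments Halt {L X A}.

(* rn: number of vertices; rm, inp: number of edges and list of edges given as
   input; rk, out: number of edges and list of edges produced as output. *)
Record program := Program {
  lab : finType;
  reg : finType;
  arr : finType;
  start : lab;
  code : lab -> instr lab reg arr;
  rn : reg;
  rm : reg;
  rk : reg;
  inp : arr;
  out : arr
}.

Inductive event (n : nat) := EdgeEv of 'I_n & 'I_n | EndEv.
Arguments EndEv {n}.

(* The port is a one-place buffer. *)
Record config (p : program) (n : nat) := Config {
  pc : lab p;
  rg : reg p -> nat;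
  mem : arr p -> nat -> nat;
  port : option (event n)
}.

Definition upd (T : eqType) (V : Type) (h : T -> V) (x : T) (v : V) : T -> V :=
  fun y => if y == x then v else h y.

Definition step p n (c : config p n) : config p n :=
  let: Config l r M s := c in
  match code l with
  | Const d k l' => Config l' (upd r d k) M s
  | Op o d x y l' => Config l' (upd r d (eval_binop o (r x) (r y))) M s
  | Fetch d a x l' => Config l' (upd r d (M a (r x))) M s
  | Store a x y l' => Config l' r (upd M a (upd (M a) (r x) (r y))) s
  | Branch x y l1 l2 => Config (if r x < r y then l1 else l2) r M s
  | Recv x y ledge lnone lend =>
      match s with
      | Some (EdgeEv u v) =>
          Config ledge (upd (upd r x (nat_of_ord u)) y (nat_of_ord v)) M None
      | Some EndEv => Config lend r M None
      | None => Config lnone r M None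
      end
  | Halt => c
  end.

Definition halted p n (c : config p n) : bool :=
  if code (pc c) is Halt then true else false.

(* The i-th edge of a list is stored in cells 2i and 2i+1. *)
Definition encode n (l : seq ('I_n * 'I_n)) : nat -> nat :=
  nth 0 (flatten [seq [:: nat_of_ord e.1; nat_of_ord e.2] | e <- l]).

Definition init p n (l : seq ('I_n * 'I_n)) : config p n :=
  Config (start p)
    (upd (upd (fun=> 0) (rm p) (size l)) (rn p) n)
    (upd (fun _ _ => 0) (inp p) (encode l))
    None.

(* An event arriving while the port is still occupied overwrites it: an edge
   that is not received before the next arrival is lost. *)
Definition arrive p n (ev : option (event n)) (c : config p n) : config p n :=
  if ev is Some e then Config (pc c) (rg c) (mem c) (Some e) else c.

Fixpoint run p n (l : seq ('I_n * 'I_n)) (arrivals : nat -> option (event n))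
    (t : nat) : config p n :=
  if t is t'.+1 then step (arrive (arrivals t') (run p l arrivals t'))
  else init p l.

Definition outputs p n (c : config p n) (G : mgraph n) : Prop :=
  exists l : seq ('I_n * 'I_n),
    [/\ edge_list G l, rg c (rk p) = size l
      & forall i, i < 2 * size l -> mem c (out p) i = encode l i].

(* c can be stored with s words of w bits per array, and w bits per register. *)
Definition fits p n (s w : nat) (c : config p n) : Prop :=
  [/\ forall x, rg c x < 2 ^ w,
      forall a i, mem c a i < 2 ^ w
    & forall a i, s <= i -> mem c a i = 0].

(* The total size in bits: arrays, registers, current label. *)
Definition bits (p : program) (s w : nat) : nat :=
  (#|arr p| * s + #|reg p|) * w + up_log 2 #|lab p|.

Definition bitlen (x : nat) : nat := (trunc_log 2 x).+1.

(** * Offline algorithms *)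

(* On each graph H with n vertices and m edges, given as an edge list in
   memory, p outputs a strong certificate with O(n) edges after at most f n m
   steps, and its memory is O(m) words of O(log (n + m)) bits.  The input port
   stays empty. *)
Definition computes_sparse_certificates (P : forall n, mgraph n -> Prop)
    (f : nat -> nat -> nat) (p : program) : Prop :=
  exists c : nat, forall n, 0 < n ->
  forall (H : mgraph n) (l : seq ('I_n * 'I_n)), edge_list H l ->
  let m := num_edges H in
  let conf := run p l (fun=> None) in
  (forall t, fits (c * m.+1) (c * bitlen (n + m)) (conf t)) /\
  exists t H',
    [/\ t <= f n m, halted (conf t), outputs (conf t) H',
        num_edges H' <= c * n & strong_certificate P H H'].

(** * Semi-streaming algorithms *)

(* Event i arrives at time tau i; the end of the stream is an event too. *)
Definition stream_arrivals n (l : seq ('I_n * 'I_n)) (tau : nat -> nat)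
    (t : nat) : option (event n) :=
  if [pick i : 'I_(size l).+1 | tau i == t] is Some i then
    Some (nth EndEv [seq EdgeEv e.1 e.2 | e <- l] i)
  else None.

Definition spaced (T : nat) (tau : nat -> nat) : Prop :=
  forall i, tau i + T <= tau i.+1.

(* With n vertices, a time of T n between consecutive arrivals is enough for q:
   for every stream of every graph G, and for arbitrary arrival times that are
   at least T n apart, q outputs a strong certificate of G with O(n) edges, and
   its memory always is O(n polylog n) bits. *)
Definition streams_sparse_certificates (P : forall n, mgraph n -> Prop)
    (T : nat -> nat) (q : program) : Prop :=
  exists c k : nat, forall n, 0 < n ->
  exists s w : nat, bits q s w <= c * (n * bitlen n ^ k) /\
  forall (G : mgraph n) (l : seq ('I_n * 'I_n)) (tau : nat -> nat),
  edge_list G l -> spaced (T n) tau ->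
  let conf := run q [::] (stream_arrivals l tau) in
  (forall t, fits s w (conf t)) /\
  exists t G',
    [/\ halted (conf t), outputs (conf t) G',
        num_edges G' <= c * n & strong_certificate P G G'].

Definition isO (u v : nat -> nat) : Prop :=
  exists c, forall n, 0 < n -> u n <= c * v n.

(* Main.v *)
From HB Require Import structures.
Require Import Defs.
From mathcomp Require Import all_boot zify.

Set Implicit Arguments.
Unset Strict Implicit.
Unset Printing Implicit Defensive.

(* The streaming machine works in rounds.  A round runs the offline algorithm
   on the union of the last certificate and of the edges buffered in the
   previous round; by composition of strong certificates, the result is a
   certificate of everything merged so far.  The port is polled before every
   single instruction of the round, and the edges that arrive go to a second
   buffer; the two buffers are exchanged between rounds.  A round takes
   O(n + f(n, O(n))) steps, so that with O(1 + f(n, O(n)) / n) steps between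
   two arrivals at most n + 1 edges arrive during a round: inputs stay O(n)
   large.  As f need not be monotone, O(n) stands for the worst input size in
   that range. *)

(** * Graphs of edge lists *)

(** The offline program is a black box that cannot pause for arrivals, while the port holds a single
    event: hence a poll before each instruction. A poll that receives an edge takes five steps, so
    [6 <= T] brings the next poll before a second arrival. Interleaving would spoil every loop
    invariant; rounds are therefore analysed as sequential runs without polls ([steps]) and
    transferred to real time ([reach_conf]), since all but a few of their instructions avoid the
    registers and the buffer that polls write. The offline program also expects a clean memory. Only
    the cells below [KL * n] are cleared, as the space bound keeps the others at zero; this linear
    cost, shared among [n] arrivals, is constant for each. The bounds are circular: the length of a
    round depends on the size of its input, which depends on the length of the previous round. The
    invariant [entry] closes the circle. Finally, the stream may end in the middle of a round, so a
    flag latched between rounds tells which round is the last. *)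

Definition list_graph n (l : seq ('I_n * 'I_n)) : mgraph n :=
  [ffun e => count (fun p => [set p.1; p.2] == val e) l].

Definition loopless n (l : seq ('I_n * 'I_n)) : bool :=
  all (fun p => p.1 != p.2) l.

Lemma edge_list_graphE n (G : mgraph n) l :
  edge_list G l -> loopless l /\ G = list_graph l.
Proof. by case=> nl cG; split=> //; apply/ffunP => e; rewrite ffunE cG. Qed.

Lemma edge_list_list_graph n (l : seq ('I_n * 'I_n)) :
  loopless l -> edge_list (list_graph l) l.
Proof. by move=> nl; split=> // e; rewrite ffunE. Qed.

Lemma list_graph_cat n (l1 l2 : seq ('I_n * 'I_n)) :
  list_graph (l1 ++ l2) = gunion (list_graph l1) (list_graph l2).
Proof. by apply/ffunP => e; rewrite !ffunE count_cat. Qed.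

Lemma num_edges_list_graph n (l : seq ('I_n * 'I_n)) :
  loopless l -> num_edges (list_graph l) = size l.
Proof.
rewrite /num_edges; elim: l => [_|p l IH /= /andP[np nl]].
  by rewrite big1 // => e _; rewrite ffunE.
under eq_bigr => e _ do rewrite ffunE /=.
rewrite big_split /= -[RHS]add1n; congr (_ + _); last first.
  by rewrite -[RHS](IH nl); apply: eq_bigr => e _; rewrite ffunE.
have c2 : #|[set p.1; p.2]| == 2 by rewrite cards2 np.
rewrite (bigD1 (Sub [set p.1; p.2] c2 : edge n)) //= eqxx big1 ?addn0 // => e.
by rewrite -val_eqE /= eq_sym => /negbTE ->.
Qed.

Section Certificates.

Variables (P : forall n, mgraph n -> Prop) (n : nat).
Implicit Types G H : mgraph n.

Lemma strong_certificate_trans G1 G2 G3 :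
  strong_certificate P G1 G2 -> strong_certificate P G2 G3 ->
  strong_certificate P G1 G3.
Proof. by move=> c12 c23 H; rewrite c12. Qed.

Lemma gunionA G1 G2 G3 : gunion (gunion G1 G2) G3 = gunion G1 (gunion G2 G3).
Proof. by apply/ffunP => e; rewrite !ffunE addnA. Qed.

(** The test graph of a strong certificate is arbitrary, so it absorbs [H] by associativity. An
    ordinary certificate would not survive the addition of edges. *)
Lemma strong_certificate_union G G' H :
  strong_certificate P G G' ->
  strong_certificate P (gunion G H) (gunion G' H).
Proof. by move=> cGG' H'; rewrite !gunionA. Qed.

End Certificates.

(** * Encoded edge lists *)

Section Encode.

Variable n : nat.
Implicit Type l : seq ('I_n * 'I_n).

Let words l := flatten [seq [:: nat_of_ord e.1; nat_of_ord e.2] | e <- l].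

Let size_words l : size (words l) = 2 * size l.
Proof. by elim: l => //= p l IH; rewrite mulnS -IH. Qed.

Lemma encode_cat l1 l2 i :
  encode (l1 ++ l2) i =
  if i < 2 * size l1 then encode l1 i else encode l2 (i - 2 * size l1).
Proof. by rewrite /encode map_cat flatten_cat nth_cat size_words. Qed.

Lemma encode_default l i : 2 * size l <= i -> encode l i = 0.
Proof. by move=> h; rewrite /encode nth_default // size_words. Qed.

Lemma encode_rcons l u v i :
  encode (rcons l (u, v)) i =
  if i < 2 * size l then encode l i
  else if i == 2 * size l then nat_of_ord u
  else if i == (2 * size l).+1 then nat_of_ord v else 0.
Proof.
rewrite -cats1 encode_cat; case: ifP => // /negbT; rewrite -leqNgt => h.
rewrite -{2 3}(subnKC h); case: (i - _) => [|[|j]]; rewrite /encode /=.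
- by rewrite addn0 eqxx.
- by rewrite addn1 eqxx; case: eqP => //; lia.
- by rewrite nth_nil; do 2![case: eqP; first lia].
Qed.

End Encode.

(** * Register machines as state transformers *)

Lemma upd_eq (T : eqType) V (h : T -> V) x v : upd h x v x = v.
Proof. by rewrite /upd eqxx. Qed.

Lemma upd_neq (T : eqType) V (h : T -> V) x v y : y != x -> upd h x v y = h y.
Proof. by rewrite /upd => /negbTE ->. Qed.

Section States.

Variables (L R A : finType).

(** Configurations without the port: only [Recv] looks at it, so the other instructions act on these
    triples. *)
Definition state := (L * (R -> nat) * (A -> nat -> nat))%type.

Definition exec (i : instr L R A) (s : state) : state :=
  let: (l, r, M) := s in
  match i with
  | Const d k l' => (l', upd r d k, M)
  | Op o d x y l' => (l', upd r d (eval_binop o (r x) (r y)), M)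
  | Fetch d a x l' => (l', upd r d (M a (r x)), M)
  | Store a x y l' => (l', r, upd M a (upd (M a) (r x) (r y)))
  | Branch x y l1 l2 => (if r x < r y then l1 else l2, r, M)
  | Recv _ _ _ _ _ | Halt => s
  end.

Definition fits_in (s w : nat) (r : R -> nat) (M : A -> nat -> nat) : Prop :=
  [/\ forall x, r x < 2 ^ w, forall a i, M a i < 2 ^ w
    & forall a i, s <= i -> M a i = 0].

Lemma fits_in_reg s w r M x k :
  fits_in s w r M -> k < 2 ^ w -> fits_in s w (upd r x k) M.
Proof. by case=> fr fM f0 kw; split=> // y; rewrite /upd; case: ifP. Qed.

Lemma fits_in_mem s w r M a i k : fits_in s w r M -> k < 2 ^ w ->
  (s <= i -> k = 0) -> fits_in s w r (upd M a (upd (M a) i k)).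
Proof.
move=> [fr fM f0] kw k0; split=> // a' j; rewrite /upd.
  by case: ifP => // _; case: ifP.
case: ifP => _; last exact: f0.
by case: eqP => [-> /k0|_]; last exact: f0.
Qed.

End States.

(** * Interleaving a program with the reception of edges *)

Inductive stage := Poll | PutU | IncU | PutV | IncV | PutEnd | Exec.

(** The injection into an ordinal only provides the finite type structure that [program] demands;
    the other enumerations are treated in the same way. *)
Definition stage_rank (s : stage) : 'I_7 :=
  match s with
  | Poll => @Ordinal 7 0 isT | PutU => @Ordinal 7 1 isT
  | IncU => @Ordinal 7 2 isT | PutV => @Ordinal 7 3 isT
  | IncV => @Ordinal 7 4 isT | PutEnd => @Ordinal 7 5 isT
  | Exec => @Ordinal 7 6 isT
  end.

Definition stage_of_rank (i : 'I_7) : stage :=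
  nth Exec [:: Poll; PutU; IncU; PutV; IncV; PutEnd] i.

Lemma stage_rankK : cancel stage_rank stage_of_rank.
Proof. by case. Qed.

HB.instance Definition _ := Finite.copy stage (can_type stage_rankK).

Definition relabel L L' R A (h : L -> L') (i : instr L R A) : instr L' R A :=
  match i with
  | Const d k l => Const _ d k (h l)
  | Op o d x y l => Op _ o d x y (h l)
  | Fetch d a x l => Fetch d a x (h l)
  | Store a x y l => Store a x y (h l)
  | Branch x y l1 l2 => Branch _ x y (h l1) (h l2)
  | Recv x y l1 l2 l3 => Recv _ x y (h l1) (h l2) (h l3)
  | Halt => Halt
  end.

Definition slice (T : Type) (l : seq T) (k0 k : nat) := drop k0 (take k l).

Lemma size_slice T (l : seq T) k0 k : size (slice l k0 k) <= k - k0.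
Proof. by rewrite /slice size_drop size_take; case: ltnP; lia. Qed.

Section Polled.

Variables (L R A : finType) (code0 : L -> instr L R A) (start0 : L).
Variables (tl : L -> R) (bf : L -> A) (u v e one nreg kreg : R) (outa : A).

(** Array and register names are static, so the buffer in use and its length register are functions
    of the label. Moving to labels of the other phase then exchanges the buffers without copying
    them. *)
Definition polled_code (ls : L * stage) : instr (L * stage)%type R A :=
  let: (l, s) := ls in
  match s with
  | Poll => Recv _ u v (l, PutU) (l, Exec) (l, PutEnd)
  | PutU => Store (bf l) (tl l) u (l, IncU)
  | IncU => Op _ Add (tl l) (tl l) one (l, PutV)
  | PutV => Store (bf l) (tl l) v (l, IncV)
  | IncV => Op _ Add (tl l) (tl l) one (l, Exec)
  | PutEnd => Const _ e 1 (l, Exec)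
  | Exec => relabel (fun l' => (l', Poll)) (code0 l)
  end.

(* The first instruction runs before any poll: it has to set [one]. *)
Definition polled : program :=
  @Program (L * stage)%type R A (start0, Exec) polled_code nreg kreg kreg
    outa outa.

Definition volatile (l : L) : seq R := [:: u; v; e; tl l].

Definition safe (l : L) (i : instr L R A) : bool :=
  let ok x := x \notin volatile l in
  let okd d := ok d && (d != one) in
  match i with
  | Const d _ _ => okd d
  | Op _ d x y _ => [&& okd d, ok x & ok y]
  | Fetch d a x _ => [&& okd d, ok x & a != bf l]
  | Store a x y _ => [&& ok x, ok y & a != bf l]
  | Branch x y _ _ => ok x && ok y
  | Recv _ _ _ _ _ | Halt => false
  end.

Definition agree (l : L) (r : R -> nat) (M : A -> nat -> nat) r0 M0 : Prop :=
  (forall x, x \notin volatile l -> r x = r0 x) /\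
  (forall a, a != bf l -> M a =1 M0 a).

(** A safe instruction neither reads nor writes what polls may change, so it acts alike on two
    states that differ only there. It also preserves [one], on which polls rely. *)
Lemma agree_exec l i l1 r M r0 M0 :
  safe l i -> agree l r M r0 M0 ->
  let s := exec i (l1, r, M) in let s0 := exec i (l1, r0, M0) in
  [/\ s.1.1 = s0.1.1, agree l s.1.2 s.2 s0.1.2 s0.2,
      forall x, x \in volatile l -> s.1.2 x = r x
    & s.2 (bf l) =1 M (bf l) /\ s.1.2 one = r one].
Proof.
move=> + [ar aM].
have neq x d : x \in volatile l -> d \notin volatile l -> x != d.
  by move=> xv; apply: contraNneq => <-.
have updP d k k0 : (d \notin volatile l) && (d != one) -> k = k0 ->
  [/\ agree l (upd r d k) M (upd r0 d k0) M0,
      forall x, x \in volatile l -> upd r d k x = r x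
    & upd r d k one = r one].
  case/andP=> dv d1 <-; split=> [|x xv|]; last by rewrite upd_neq // eq_sym.
    by split=> // x xv; rewrite /upd; case: ifP => // _; rewrite ar.
  by rewrite upd_neq ?neq.
case: i => [d k l'|o d x y l'|d a x l'|a x y l'|x y l' l''|//|//] /=.
- by move=> /updP/(_ (erefl k))[].
- by case/and3P=> /updP dv xv yv; case: (dv _ _ (congr2 (eval_binop o) (ar _ xv) (ar _ yv))).
- case/and3P=> /updP dv xv ab.
  have /dv[] : M a (r x) = M0 a (r0 x) by rewrite ar ?aM.
  by [].
- case/and3P=> xv yv ab; split=> //; last first.
    by split=> // i; rewrite upd_neq // eq_sym.
  split=> // a' a'b i; rewrite /upd (ar _ xv) (ar _ yv).
  case: eqP => _ /=; last exact: aM.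
  by case: ifP => // _; exact: aM.
- by case/andP=> xv yv; split=> //; rewrite !ar.
Qed.

Hypothesis pollregs_uniq : forall l, uniq [:: u; v; e; one; tl l].

Lemma one_notin_volatile l : one \notin volatile l.
Proof.
have := pollregs_uniq l; rewrite /= !inE !negb_or.
case/and5P=> /and4P[_ _ h1 _] /and3P[_ h2 _] /andP[h3 _] h4 _.
by rewrite eq_sym h1 eq_sym h2 eq_sym h3 h4.
Qed.

Lemma pollregs_neq l :
  [/\ u != tl l, v != tl l, u != v, tl l != u & tl l != v] /\
  [/\ e != tl l, one != tl l, one != u, one != v & tl l != e] /\
  e != u /\ e != v.
Proof.
have := pollregs_uniq l; rewrite /= !inE !negb_or.
case/and5P=> /and4P[uv ue uo ut] /and3P[ve vo vt] /andP[eo et] ot _.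
by do !split=> //; rewrite eq_sym.
Qed.

(** * Timing of arrivals and polls *)

Section Stream.

Variables (n : nat) (l : seq ('I_n * 'I_n)) (tau : nat -> nat) (T : nat).
Hypotheses (tauT : spaced T tau) (T6 : 6 <= T).

Local Notation Cfg := (@Config polled n).

Variable conf : nat -> config polled n.
Hypothesis confS : forall t,
  conf t.+1 = step (arrive (stream_arrivals l tau t) (conf t)).

Let evs := [seq EdgeEv e.1 e.2 | e <- l].

(* The content of the port at time [t] when [k] events have been received. *)
Definition portat (t k : nat) : option (event n) :=
  if (k <= size l) && (tau k < t) then Some (nth EndEv evs k) else None.

(* At time [t], [k] events have been received and no event has been lost. *)
Definition clock (t k : nat) : Prop :=
  [/\ k <= (size l).+1, 0 < k -> tau k.-1 < t & k <= size l -> t < tau k.+1].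

Lemma spaced_le i j : i <= j -> tau i + (j - i) * T <= tau j.
Proof.
elim: j => [|j IH]; first by rewrite leqn0 => /eqP ->; rewrite mul0n addn0.
rewrite leq_eqVlt => /predU1P[<-|]; first by rewrite subnn mul0n addn0.
move=> ij; have := IH ij; have := tauT j; rewrite subSn // mulSn; lia.
Qed.

(** Event [ks] may be waiting in the port at time [ts], but event [ks.+1] is still to come. This
    waiting event accounts for the successor in [d.+1]. *)
Lemma clock_bound ts ks t k d :
  clock ts ks -> clock t k -> ks <= k -> t <= ts + d * T -> k <= ks + d.+1.
Proof.
move=> [_ _ late] [kl past _] ksk td.
have [//|ltk] := leqP k (ks + d.+1).
have ksl : ks <= size l by lia.
have k0 : 0 < k by lia.
have ksk1 : ks.+1 <= k.-1 by lia.
have := spaced_le ksk1; have := late ksl; have := past k0.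
have : d * T <= (k.-1 - ks.+1) * T by rewrite leq_mul2r; apply/orP; right; lia.
lia.
Qed.

(** The clock leaves event [k] as the only one that can arrive at time [t]. It finds the port empty,
    so nothing is overwritten. *)
Lemma conf_step t k lb r M :
  conf t = Cfg lb r M (portat t k) -> clock t k ->
  conf t.+1 = step (Cfg lb r M (portat t.+1 k)).
Proof.
move=> Et [kl past late]; rewrite confS Et; congr (step _).
rewrite /stream_arrivals; case: pickP => [i /eqP Ei|ni] /=.
  suff Ek : k = i :> nat by rewrite /portat -Ek Ek -ltnS ltn_ord Ei leqnn.
  have il : i <= size l by rewrite -ltnS.
  have [ki|ik|//] := ltngtP k i.
    by have := spaced_le ki; have := late (leq_trans (ltnW ki) il); lia.
  have k0 : 0 < k by apply: leq_ltn_trans ik.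
  have ik1 : i <= k.-1 by lia.
  by have := spaced_le ik1; have := past k0; lia.
congr Config; rewrite /portat; case: (leqP k) => //= kl'.
have := ni (Ordinal (kl' : k < (size l).+1)) => /= tk.
by rewrite ltnS [in RHS]leq_eqVlt tk.
Qed.

Definition received t k := (k <= size l) && (tau k <= t).

(** The next event that could cause a loss comes more than [T] after the poll: this is the time left
    before the next poll is due. *)
Lemma clock_poll t k : clock t k ->
  let k' := if received t k then k.+1 else k in
  portat t.+1 k' = None /\ forall t', t < t' <= t + T -> clock t' k'.
Proof.
move=> [kl past late]; rewrite /received; case: (leqP k) => [kl'|lk] /=.
  have := late kl'; have := tauT k; have := tauT k.+1; case: (leqP (tau k) t) => tk t1 t2 t3.
    split; first by rewrite /portat; case: ifP => //; lia.
    by move=> t' tt'; split=> //=; lia.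
  split; first by rewrite /portat; case: ifP => //; lia.
  move=> t' tt'; split=> // [k0|_]; last by lia.
  by apply: leq_trans (past k0) _; lia.
split; first by rewrite /portat leqNgt lk.
move=> t' tt'; split=> // [k0|]; last by lia.
by apply: leq_trans (past k0) _; lia.
Qed.

(* The buffer of label [l0] holds the edges received since event [k0]. *)
Definition buffered (k0 k : nat) (l0 : L) (r : R -> nat) (M : A -> nat -> nat) : Prop :=
  [/\ r (tl l0) = 2 * size (slice l k0 k),
      forall i, i < 2 * size (slice l k0 k) -> M (bf l0) i = encode (slice l k0 k) i
    & r e = (size l < k)].

#[local] Arguments exec : simpl never.

Variables (s w : nat).
Hypothesis n2w : n < 2 ^ w.

(** The worst case is an edge: one reception, two stores and two increments. The instruction that
    follows is the sixth step, and the clock is asserted at [t'.+1] to cover it. *)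
Lemma poll k0 t k (l0 : L) r M :
  conf t = Cfg (l0, Poll) r M (portat t k) -> clock t k ->
  k0 <= k -> r one = 1 -> buffered k0 k l0 r M -> fits_in s w r M ->
  2 * size (slice l k0 k) + 2 <= s -> 2 * size (slice l k0 k) + 2 < 2 ^ w ->
  exists t' k' r' M',
    [/\ t < t' <= t + 5,
        conf t' = Cfg (l0, Exec) r' M' (portat t' k'),
        clock t' k' /\ clock t'.+1 k',
        buffered k0 k' l0 r' M' /\ agree l0 r' M' r M
      & k <= k' /\ forall i, t <= i <= t' -> fits s w (conf i)].
Proof.
move=> Et ck k0k one1 [btl bM be] fr ss sw.
have /clock_poll [pk ck'] := ck.
have := conf_step Et ck => /=.
have -> : portat t.+1 k = if received t k then Some (nth EndEv evs k) else None.
  by [].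
have fits_t : fits s w (conf t) by rewrite Et.
have one2w : 1 < 2 ^ w by lia.
move: pk ck'; rewrite /received; case: (leqP k) => [kl|lk] /=; last first.
  move=> pk ck' E1; exists t.+1, k, r, M; split=> //; first by lia.
  - by rewrite pk.
  - by split; apply: ck'; lia.
  - split=> // i ti; have [->|->] : i = t \/ i = t.+1 by lia.
      by [].
    by rewrite E1.
case: (leqP (tau k) t) => [tk|tk] pk ck'; last first.
  move=> E1; exists t.+1, k, r, M; split=> //; first by lia.
  - by rewrite pk.
  - by split; apply: ck'; lia.
  - split=> // i ti; have [->|->] : i = t \/ i = t.+1 by lia.
      by [].
    by rewrite E1.
move: kl; rewrite leq_eqVlt => /predU1P[kl|kl].
  rewrite kl nth_default ?size_map // -kl => E1.
  have {}E1 : conf t.+1 = Cfg (l0, PutEnd) r M (portat t.+1 k.+1).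
    by rewrite E1 pk.
  have ck1 : clock t.+1 k.+1 by apply: ck'; lia.
  have E2 := conf_step E1 ck1; rewrite /= in E2.
  (* The end of the stream counts as an event but contributes no edge. *)
  have sl : slice l k0 k.+1 = slice l k0 k.
    by rewrite /slice !take_oversize // kl.
  exists t.+2, k.+1, (upd r e 1), M; split=> //; first by lia.
  - by split; apply: ck'; lia.
  - split; first split.
    + have [[? ? ? ? ?] [[? ? ? ? ?] [? ?]]] := pollregs_neq l0.
      by rewrite sl upd_neq.
    + by rewrite sl.
    + by rewrite upd_eq kl ltnS leqnn.
    split=> // x; rewrite !inE !negb_or => /and4P[_ _ xe _].
    by rewrite upd_neq.
  - split=> // i ti; have [->|[->|->]] : i = t \/ i = t.+1 \/ i = t.+2 by lia.
    + by [].
    + by rewrite E1.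
    + by rewrite E2; exact: fits_in_reg.
(* As [n] may be 0 here, there is no default vertex; the element is taken from [l] itself. *)
have [[a b] Ep] : exists ab, forall d, nth d l k = ab.
  by exists (tnth (in_tuple l) (Ordinal kl)) => d; rewrite (tnth_nth d).
rewrite (nth_map (a, b)) // Ep /= => E1.
set r1 := upd _ _ _ in E1.
have {}E1 : conf t.+1 = Cfg (l0, PutU) r1 M (portat t.+1 k.+1).
  by rewrite E1 pk.
have E2 := conf_step E1 (ck' t.+1 ltac:(lia)); rewrite /= in E2.
set M2 := upd M _ _ in E2.
have E3 := conf_step E2 (ck' t.+2 ltac:(lia)); rewrite /= in E3.
set r3 := upd r1 _ _ in E3.
have E4 := conf_step E3 (ck' t.+3 ltac:(lia)); rewrite /= in E4.
set M4 := upd M2 _ _ in E4.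
have E5 := conf_step E4 (ck' t.+4 ltac:(lia)); rewrite /= in E5.
set r5 := upd r3 _ _ in E5.
set S := slice l k0 k in btl bM ss sw.
have sl : slice l k0 k.+1 = rcons S (a, b).
  rewrite /S /slice (take_nth (a, b)) // Ep drop_rcons //.
  by rewrite size_takel // ltnW.
have r1tl : r1 (tl l0) = 2 * size S.
  have [[? ? ? ? ?] [[? ? ? ? ?] [? ?]]] := pollregs_neq l0.
  by rewrite /r1 upd_neq // upd_neq.
have r1u : r1 u = a.
  have [[? ? ? ? ?] [[? ? ? ? ?] [? ?]]] := pollregs_neq l0.
  by rewrite /r1 upd_neq // upd_eq.
have r1one : r1 one = 1.
  have [[? ? ? ? ?] [[? ? ? ? ?] [? ?]]] := pollregs_neq l0.
  by rewrite /r1 upd_neq // upd_neq.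
have r3tl : r3 (tl l0) = (2 * size S).+1.
  by rewrite /r3 upd_eq /= r1tl r1one addn1.
have r3v : r3 v = b.
  have [[? ? ? ? ?] [[? ? ? ? ?] [? ?]]] := pollregs_neq l0.
  by rewrite /r3 upd_neq // /r1 upd_eq.
have r3one : r3 one = 1.
  have [[? ? ? ? ?] [[? ? ? ? ?] [? ?]]] := pollregs_neq l0.
  by rewrite /r3 upd_neq.
have r5tl : r5 (tl l0) = (2 * size S).+2.
  by rewrite /r5 upd_eq /= r3tl r3one addn1.
have fa : a < 2 ^ w by apply: ltn_trans n2w.
have fb : b < 2 ^ w by apply: ltn_trans n2w.
have f1 : fits_in s w r1 M by apply: fits_in_reg => //; exact: fits_in_reg.
have f2 : fits_in s w r1 M2.
  by apply: fits_in_mem; rewrite ?r1u ?r1tl //; lia.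
have f3 : fits_in s w r3 M2.
  by apply: fits_in_reg; rewrite /= ?r1tl ?r1one //; lia.
have f4 : fits_in s w r3 M4.
  by apply: fits_in_mem; rewrite ?r3v ?r3tl //; lia.
have f5 : fits_in s w r5 M4.
  by apply: fits_in_reg; rewrite /= ?r3tl ?r3one //; lia.
exists t.+4.+1, k.+1, r5, M4; split=> //; first by lia.
- by split; apply: ck'; lia.
- split; first split.
  + by rewrite r5tl sl size_rcons mulnS addnC addn2.
  + rewrite sl size_rcons => i iS; rewrite encode_rcons.
    rewrite /M4 upd_eq r3tl r3v /M2 upd_eq r1tl r1u.
    case: ltngtP => [iS'|iS'|->]; last by rewrite upd_neq ?upd_eq //; lia.
      by rewrite !upd_neq ?bM //; lia.
    have -> : i = (2 * size S).+1 by lia.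
    by rewrite upd_eq eqxx.
  + have -> : r5 e = r e.
      have [[? ? ? ? ?] [[? ? ? ? ?] [? ?]]] := pollregs_neq l0.
      by rewrite /r5 upd_neq // /r3 upd_neq // /r1 upd_neq // upd_neq.
    by rewrite be; lia.
  split=> [x|a' a'b i].
    rewrite !inE !negb_or => /and4P[xu xv xe xt].
    by rewrite /r5 upd_neq // /r3 upd_neq // /r1 upd_neq // upd_neq.
  by rewrite /M4 upd_neq // /M2 upd_neq.
- split=> // i ti.
  have [->|[->|[->|[->|[->|->]]]]] : i = t \/ i = t.+1 \/ i = t.+2 \/
    i = t.+3 \/ i = t.+4 \/ i = t.+4.+1 by lia.
  + by [].
  + by rewrite E1.
  + by rewrite E2.
  + by rewrite E3.
  + by rewrite E4.
  + by rewrite E5.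
Qed.

(** * From sequential runs to the polled machine *)

Definition plain (i : instr L R A) : bool :=
  match i with Recv _ _ _ _ _ | Halt => false | _ => true end.

Lemma conf_exec t k (l0 : L) r M :
  conf t = Cfg (l0, Exec) r M (portat t k) -> clock t k ->
  plain (code0 l0) ->
  let s := exec (code0 l0) (l0, r, M) in
  conf t.+1 = Cfg (s.1.1, Poll) s.1.2 s.2 (portat t.+1 k).
Proof.
move=> Et ck; rewrite (conf_step Et ck) /=.
by case: (code0 l0) => //= x y l1 l2 _; case: ifP.
Qed.

Definition mstep (st : state L R A) : state L R A := exec (code0 st.1.1) st.

#[local] Arguments mstep : simpl never.

(* [j] safe steps of [code0] without polls, through configurations that fit,
   all with the buffer of [l0]. *)
Fixpoint reach (l0 : L) (j : nat) (st st' : state L R A) : Prop :=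
  if j is j'.+1 then
    let st1 := mstep st in
    [/\ safe l0 (code0 st.1.1), bf st.1.1 = bf l0, tl st.1.1 = tl l0,
        fits_in s w st1.1.2 st1.2 & reach l0 j' st1 st']
  else st = st'.

Lemma reachS l0 j st st1 st' :
  safe l0 (code0 st.1.1) -> bf st.1.1 = bf l0 -> tl st.1.1 = tl l0 ->
  exec (code0 st.1.1) st = st1 -> fits_in s w st1.1.2 st1.2 ->
  reach l0 j st1 st' -> reach l0 j.+1 st st'.
Proof. by move=> ? ? ? <-. Qed.

Lemma reach_cat l0 i j st1 st2 st3 :
  reach l0 i st1 st2 -> reach l0 j st2 st3 -> reach l0 (i + j) st1 st3.
Proof.
elim: i st1 => [|i IH] st1 /=; first by move=> ->.
by case=> *; split=> //; exact: IH.
Qed.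

Hypotheses (ns : 2 * n + 4 <= s) (n2w4 : 2 * n + 4 < 2 ^ w).

(** During [n * T] steps at most [n.+1] events are received; two cells for each, and two for a
    further edge, make [2 * n + 4]. *)
Lemma poll_in_time ts ks t k (l0 : L) r M :
  conf t = Cfg (l0, Poll) r M (portat t k) -> clock t k -> clock ts ks ->
  ks <= k -> t <= ts + n * T ->
  r one = 1 -> buffered ks k l0 r M -> fits_in s w r M ->
  exists t' k' r' M',
    [/\ t < t' <= t + 5,
        conf t' = Cfg (l0, Exec) r' M' (portat t' k'),
        clock t' k' /\ clock t'.+1 k',
        buffered ks k' l0 r' M' /\ agree l0 r' M' r M
      & k <= k' /\ forall i, t <= i <= t' -> fits s w (conf i)].
Proof.
move=> Et ck cks ksk tn one1 bk fr.
have kn := clock_bound cks ck ksk tn; have sz := size_slice l ks k.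
by apply: poll => //; lia.
Qed.

(** Each sequential instruction costs at most six steps, poll included. What the polls alter is
    exactly what [agree] ignores, so the two runs never diverge. *)
Lemma reach_conf ts ks l0 j st st' t k r M :
  clock ts ks -> reach l0 j st st' ->
  conf t = Cfg (st.1.1, Poll) r M (portat t k) -> clock t k ->
  ks <= k -> t + 6 * j <= ts + n * T -> r one = 1 ->
  agree l0 r M st.1.2 st.2 -> buffered ks k l0 r M -> fits_in s w r M ->
  exists t' k' r' M',
    [/\ t <= t' <= t + 6 * j,
        conf t' = Cfg (st'.1.1, Poll) r' M' (portat t' k') /\ clock t' k',
        r' one = 1 /\ agree l0 r' M' st'.1.2 st'.2,
        buffered ks k' l0 r' M'
      & k <= k' /\ forall i, t <= i <= t' -> fits s w (conf i)].
Proof.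
move=> cks; elim: j st t k r M => [|j IH] st t k r M.
  move=> <- Et ck ksk tn one1 ag bk fr; exists t, k, r, M; split=> //.
    by lia.
  split=> // i ti; have -> : i = t by lia.
  by rewrite Et.
case: st => [[l1 r1] M1] /= [sf bfE tlE fst1 rst] Et ck ksk tn one1 ag bk fr.
have bk1 : buffered ks k l1 r M by case: bk => *; split; rewrite ?bfE ?tlE.
have tn' : t <= ts + n * T by lia.
have [t2 [k2 [r2 [M2 [tt2 E2 [ck2 ck2'] [b2 ag2] [kk2 fi2]]]]]] :=
  poll_in_time Et ck cks ksk tn' one1 bk1 fr.
have {}b2 : buffered ks k2 l0 r2 M2 by case: b2; rewrite tlE bfE; split.
have {}ag2 : agree l0 r2 M2 r1 M1.
  move: ag2; rewrite /agree /volatile tlE bfE => -[ar aM].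
  case: ag => ar' aM'; split=> [x xv|a ab i]; first by rewrite ar ?ar'.
  by rewrite aM ?aM'.
have f2 : fits_in s w r2 M2.
  by have := fi2 t2; rewrite E2; apply; lia.
have one2 : r2 one = 1.
  case: ag2 => ar _; case: ag => ar' _.
  by rewrite ar ?one_notin_volatile // -ar' ?one_notin_volatile.
have pl : plain (code0 l1) by move: sf; case: (code0 l1).
have := conf_exec E2 ck2 pl.
have := agree_exec l1 sf ag2; rewrite /mstep /= in fst1 rst *.
move: rst fst1; case: (exec (code0 l1) (l1, r1, M1)) => [[l3 r3] M3] /=.
case: (exec (code0 l1) (l1, r2, M2)) => [[l4 r4] M4] /=.
move=> rst f3 [-> ag4 vr [vM o4]] E4.
(* The volatile part is as the poll left it, so its bound comes from the real run; everything else
   agrees with the sequential run, which supplies the bound there. *)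
have f4 : fits_in s w r4 M4.
  case: f2 => fr2 fM2 f02; case: f3 => fr3 fM3 f03; case: ag4 => ar aM; split.
  - move=> x; case xv : (x \in volatile l0); first by rewrite vr.
    by rewrite ar ?xv //; exact: fr3.
  - by move=> a i; have [->|ab] := eqVneq a (bf l0); [rewrite vM | rewrite aM // fM3].
  - move=> a i; have [->|ab] := eqVneq a (bf l0); first by rewrite vM; exact: f02.
    by rewrite aM //; exact: f03.
have b4 : buffered ks k2 l0 r4 M4.
  case: b2 => b21 b22 b23; split.
  - by rewrite vr // !inE eqxx !orbT.
  - by move=> i ik; rewrite vM b22.
  - by rewrite vr // !inE eqxx !orbT.
have k4 : ks <= k2 by lia.
have tn4 : t2.+1 + 6 * j <= ts + n * T by lia.
have o41 : r4 one = 1 by rewrite o4.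
have [t5 [k5 [r5 [M5 [tt5 Eck ro5 b5 [kk5 fi5]]]]]] :=
  IH _ _ _ _ _ rst E4 ck2' k4 tn4 o41 ag4 b4 f4.
exists t5, k5, r5, M5; split=> //; first by lia.
split; first by lia.
move=> i ti; have [it2|t2i] := leqP i t2; first by apply: fi2; lia.
by apply: fi5; lia.
Qed.

End Stream.
End Polled.

(** * The control program *)

(* RN: number of vertices; RC: number of edges of the stored certificate;
   RE: the end of the stream has been received; RF: it had been received when
   the buffers were last exchanged; RU, RV: endpoints of the received edge;
   RI, RJ, RK, RX, RLim: indices and bounds of the loops. *)
Inductive sreg := RN | ROne | RZero | RF | RE | RU | RV | RC | RI | RJ | RK | RX | RLim.

Definition sreg_rank (x : sreg) : 'I_13 :=
  match x with
  | RN => @Ordinal 13 0 isT | ROne => @Ordinal 13 1 isT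
  | RZero => @Ordinal 13 2 isT | RF => @Ordinal 13 3 isT
  | RE => @Ordinal 13 4 isT | RU => @Ordinal 13 5 isT
  | RV => @Ordinal 13 6 isT | RC => @Ordinal 13 7 isT
  | RI => @Ordinal 13 8 isT | RJ => @Ordinal 13 9 isT
  | RK => @Ordinal 13 10 isT | RX => @Ordinal 13 11 isT
  | RLim => @Ordinal 13 12 isT
  end.

Lemma sreg_rankK :
  cancel sreg_rank (nth RN [:: RN; ROne; RZero; RF; RE; RU; RV; RC; RI; RJ; RK; RX; RLim]).
Proof. by case. Qed.

HB.instance Definition _ := Finite.copy sreg (can_type sreg_rankK).

Inductive copy_kind := CertToInp | BufToInp | OutToCert.

Definition copy_kind_rank (x : copy_kind) : 'I_3 :=
  match x with
  | CertToInp => @Ordinal 3 0 isT | BufToInp => @Ordinal 3 1 isT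
  | OutToCert => @Ordinal 3 2 isT
  end.

Lemma copy_kind_rankK :
  cancel copy_kind_rank (nth CertToInp [:: CertToInp; BufToInp; OutToCert]).
Proof. by case. Qed.

HB.instance Definition _ := Finite.copy copy_kind (can_type copy_kind_rankK).

Inductive copy_stage := CInit | CTest | CFetch | CStore | CIncI | CIncJ.

Definition copy_stage_rank (x : copy_stage) : 'I_6 :=
  match x with
  | CInit => @Ordinal 6 0 isT | CTest => @Ordinal 6 1 isT
  | CFetch => @Ordinal 6 2 isT | CStore => @Ordinal 6 3 isT
  | CIncI => @Ordinal 6 4 isT | CIncJ => @Ordinal 6 5 isT
  end.

Lemma copy_stage_rankK :
  cancel copy_stage_rank (nth CInit [:: CInit; CTest; CFetch; CStore; CIncI; CIncJ]).
Proof. by case. Qed.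

HB.instance Definition _ := Finite.copy copy_stage (can_type copy_stage_rankK).

Inductive ctl :=
  SetOne | LatchEnd | SwitchPhase | LoadLim | MulLim | ClearInit | ClearTest
| LoadK | LoadJ | LoadTwo | SetM | SetN | ResetBuf | SaveC | SaveK | SaveJ
| Decide | Stop.

Definition ctl_rank (x : ctl) : 'I_18 :=
  match x with
  | SetOne => @Ordinal 18 0 isT | LatchEnd => @Ordinal 18 1 isT
  | SwitchPhase => @Ordinal 18 2 isT | LoadLim => @Ordinal 18 3 isT
  | MulLim => @Ordinal 18 4 isT | ClearInit => @Ordinal 18 5 isT
  | ClearTest => @Ordinal 18 6 isT | LoadK => @Ordinal 18 7 isT
  | LoadJ => @Ordinal 18 8 isT | LoadTwo => @Ordinal 18 9 isT
  | SetM => @Ordinal 18 10 isT | SetN => @Ordinal 18 11 isT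
  | ResetBuf => @Ordinal 18 12 isT | SaveC => @Ordinal 18 13 isT
  | SaveK => @Ordinal 18 14 isT | SaveJ => @Ordinal 18 15 isT
  | Decide => @Ordinal 18 16 isT | Stop => @Ordinal 18 17 isT
  end.

Lemma ctl_rankK :
  cancel ctl_rank (nth SetOne [:: SetOne; LatchEnd; SwitchPhase; LoadLim; MulLim;
    ClearInit; ClearTest; LoadK; LoadJ; LoadTwo; SetM; SetN; ResetBuf; SaveC;
    SaveK; SaveJ; Decide; Stop]).
Proof. by case. Qed.

HB.instance Definition _ := Finite.copy ctl (can_type ctl_rankK).

Section Control.

Variables (p : program) (KL : nat).

(** No instruction can compute the name of an array or a register, so clearing all of them is
    unrolled in the control, with one label for each. The extra index is the exit. *)
Inductive clab :=
| Sim of lab p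
| ClearArr of 'I_#|arr p|.+1
| ClearReg of 'I_#|reg p|.+1
| Copy of copy_kind & copy_stage
| Ctl of ctl.

Definition clab_sum (l : clab) :
    lab p + ('I_#|arr p|.+1 + ('I_#|reg p|.+1 + (copy_kind * copy_stage + ctl))) :=
  match l with
  | Sim l => inl l
  | ClearArr i => inr (inl i)
  | ClearReg i => inr (inr (inl i))
  | Copy k c => inr (inr (inr (inl (k, c))))
  | Ctl c => inr (inr (inr (inr c)))
  end.

Definition sum_clab
    (x : lab p + ('I_#|arr p|.+1 + ('I_#|reg p|.+1 + (copy_kind * copy_stage + ctl)))) :=
  match x with
  | inl l => Sim l
  | inr (inl i) => ClearArr i
  | inr (inr (inl i)) => ClearReg i
  | inr (inr (inr (inl (k, c)))) => Copy k c
  | inr (inr (inr (inr c))) => Ctl c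
  end.

Lemma clab_sumK : cancel clab_sum sum_clab.
Proof. by case. Qed.

HB.instance Definition _ := Finite.copy clab (can_type clab_sumK).

Local Notation creg := (reg p + (bool + sreg))%type.
Local Notation carr := (arr p + option bool)%type.
Local Notation clabel := (bool * clab)%type.

Definition sr (x : sreg) : creg := inr (inr x).
Definition bufreg (b : bool) : creg := inr (inl b).
Definition certarr : carr := inr None.
Definition bufarr (b : bool) : carr := inr (Some b).

Definition jump (l : clabel) : instr clabel creg carr :=
  Branch _ (sr ROne) (sr ROne) l l.

(* The simulated program never sees an edge. *)
Definition sim_code (b : bool) (i : instr (lab p) (reg p) (arr p)) :
    instr clabel creg carr :=
  match i with
  | Const d k l => Const _ (inl d) k (b, Sim l)
  | Op o d x y l => Op _ o (inl d) (inl x) (inl y) (b, Sim l)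
  | Fetch d a x l => Fetch (inl d) (inl a) (inl x) (b, Sim l)
  | Store a x y l => Store (inl a) (inl x) (inl y) (b, Sim l)
  | Branch x y l1 l2 => Branch _ (inl x) (inl y) (b, Sim l1) (b, Sim l2)
  | Recv _ _ _ l _ => jump (b, Sim l)
  | Halt => jump (b, Ctl SaveC)
  end.

Definition copy_src (b : bool) (k : copy_kind) : carr :=
  match k with
  | CertToInp => certarr | BufToInp => bufarr (~~ b) | OutToCert => inl (out p)
  end.

Definition copy_dst (k : copy_kind) : carr :=
  if k is OutToCert then certarr else inl (inp p).

Definition copy_bound (b : bool) (k : copy_kind) : creg :=
  if k is BufToInp then bufreg (~~ b) else sr RK.

Definition copy_exit (k : copy_kind) : clab :=
  match k with
  | CertToInp => Copy BufToInp CInit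
  | BufToInp => Ctl LoadTwo
  | OutToCert => Ctl Decide
  end.

(* In phase [b] the polls fill buffer [b], while the control program consumes
   buffer [~~ b]. *)
Definition ctl_code (bl : clabel) : instr clabel creg carr :=
  let: (b, l) := bl in
  let const d k l' := Const _ d k (b, l') in
  let op o d x y l' := Op _ o d x y (b, l') in
  match l with
  | Sim l => sim_code b (code l)
  | ClearArr i =>
      if i < #|arr p| then
        Store (inl (nth (inp p) (enum (arr p)) i)) (sr RI) (sr RZero)
          (b, ClearArr (inord i.+1))
      else op Add (sr RI) (sr RI) (sr ROne) (Ctl ClearTest)
  | ClearReg i =>
      if i < #|reg p| then
        const (inl (nth (rm p) (enum (reg p)) i)) 0 (ClearReg (inord i.+1))
      else jump (b, Ctl LoadK)
  | Copy k CInit => const (sr RI) 0 (Copy k CTest)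
  | Copy k CTest =>
      Branch _ (sr RI) (copy_bound b k) (b, Copy k CFetch) (b, copy_exit k)
  | Copy k CFetch => Fetch (sr RX) (copy_src b k) (sr RI) (b, Copy k CStore)
  | Copy k CStore => Store (copy_dst k) (sr RJ) (sr RX) (b, Copy k CIncI)
  | Copy k CIncI => op Add (sr RI) (sr RI) (sr ROne) (Copy k CIncJ)
  | Copy k CIncJ => op Add (sr RJ) (sr RJ) (sr ROne) (Copy k CTest)
  | Ctl SetOne => const (sr ROne) 1 (Ctl LoadLim)
  | Ctl LatchEnd => op Add (sr RF) (sr RE) (sr RZero) (Ctl SwitchPhase)
  | Ctl SwitchPhase => Const _ (sr RI) 0 (~~ b, Ctl LoadLim)
  | Ctl LoadLim => const (sr RLim) KL (Ctl MulLim)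
  | Ctl MulLim => op Mul (sr RLim) (sr RLim) (sr RN) (Ctl ClearInit)
  | Ctl ClearInit => const (sr RI) 0 (Ctl ClearTest)
  | Ctl ClearTest =>
      Branch _ (sr RI) (sr RLim) (b, ClearArr ord0) (b, ClearReg ord0)
  | Ctl LoadK => op Add (sr RK) (sr RC) (sr RC) (Ctl LoadJ)
  | Ctl LoadJ => const (sr RJ) 0 (Copy CertToInp CInit)
  | Ctl LoadTwo => const (sr RX) 2 (Ctl SetM)
  | Ctl SetM => op Div (inl (rm p)) (sr RJ) (sr RX) (Ctl SetN)
  | Ctl SetN => op Add (inl (rn p)) (sr RN) (sr RZero) (Ctl ResetBuf)
  | Ctl ResetBuf => const (bufreg (~~ b)) 0 (Sim (start p))
  | Ctl SaveC => op Add (sr RC) (inl (rk p)) (sr RZero) (Ctl SaveK)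
  | Ctl SaveK => op Add (sr RK) (sr RC) (sr RC) (Ctl SaveJ)
  | Ctl SaveJ => const (sr RJ) 0 (Copy OutToCert CInit)
  | Ctl Decide => Branch _ (sr RF) (sr ROne) (b, Ctl LatchEnd) (b, Ctl Stop)
  | Ctl Stop => Halt
  end.

Definition buf_of (l : clabel) : carr := bufarr l.1.
Definition bufreg_of (l : clabel) : creg := bufreg l.1.

(** Input and output share [RC] and [certarr]: started on the empty list, the machine already stores
    the empty certificate. *)
Definition streamer : program :=
  polled ctl_code (false, Ctl SetOne) bufreg_of buf_of (sr RU) (sr RV) (sr RE)
    (sr ROne) (sr RN) (sr RC) certarr.

Lemma streamer_pollregs_uniq l :
  uniq [:: sr RU; sr RV; sr RE; sr ROne; bufreg_of l].
Proof. by []. Qed.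

(** * Sequential runs within one phase *)

Section Phase.

Variables (n s w : nat) (b : bool).

Local Notation home := (b, Ctl Decide).

(** [SetOne] writes the register on which polls rely, [LatchEnd] reads the end flag that polls
    write, and [Stop] halts; these are followed by hand. *)
Definition safe_label (l : clab) : bool :=
  if l is Ctl (SetOne | LatchEnd | Stop) then false else true.

Lemma safe_ctl_code l : safe_label l ->
  safe bufreg_of buf_of (sr RU) (sr RV) (sr RE) (sr ROne) home (ctl_code (b, l)).
Proof.
case: l => [l _|i _|i _|k c _|c] /=; rewrite /volatile /bufreg_of /buf_of.
- by case: (code l).
- by case: ifP.
- by case: ifP.
- by case: (b); case: k; case: c.
- by case: (b); case: c.
Qed.

(* [j] steps within phase [b]; the fit of the initial state is assumed. *)
Definition steps (j : nat) (l : clab) r M (st' : state clabel creg carr) : Prop :=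
  fits_in s w r M ->
  reach ctl_code bufreg_of buf_of (sr RU) (sr RV) (sr RE) (sr ROne) s w home j
    (b, l, r, M) st' /\ fits_in s w st'.1.2 st'.2.

Lemma steps0 l r M : steps 0 l r M (b, l, r, M).
Proof. by []. Qed.

Lemma steps_cat i j l r M l1 r1 M1 st' :
  steps i l r M (b, l1, r1, M1) -> steps j l1 r1 M1 st' ->
  steps (i + j) l r M st'.
Proof.
move=> h1 h2 /h1[re1 /h2[re2 f2]]; split=> //; exact: reach_cat re1 re2.
Qed.

Lemma stepsS j l l1 r1 M1 r M st' : safe_label l ->
  exec (ctl_code (b, l)) (b, l, r, M) = (b, l1, r1, M1) ->
  (fits_in s w r M -> fits_in s w r1 M1) ->
  steps j l1 r1 M1 st' -> steps j.+1 l r M st'.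
Proof.
move=> sl Ee f1 h fr; have [re fe] := h (f1 fr); split=> //.
by apply: reachS Ee (f1 fr) re => //; exact: safe_ctl_code.
Qed.

Lemma steps_const j l d k l1 r M st' :
  ctl_code (b, l) = Const _ d k (b, l1) -> safe_label l -> k < 2 ^ w ->
  steps j l1 (upd r d k) M st' -> steps j.+1 l r M st'.
Proof.
move=> Ec sl kw; apply: stepsS => //; first by rewrite Ec.
by move=> fr; exact: fits_in_reg.
Qed.

Lemma steps_op j l o d x y l1 r M st' :
  ctl_code (b, l) = Op _ o d x y (b, l1) -> safe_label l ->
  eval_binop o (r x) (r y) < 2 ^ w ->
  steps j l1 (upd r d (eval_binop o (r x) (r y))) M st' -> steps j.+1 l r M st'.
Proof.
move=> Ec sl kw; apply: stepsS => //; first by rewrite Ec.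
by move=> fr; exact: fits_in_reg.
Qed.

Lemma steps_fetch j l d a x l1 r M st' :
  ctl_code (b, l) = Fetch d a x (b, l1) -> safe_label l ->
  steps j l1 (upd r d (M a (r x))) M st' -> steps j.+1 l r M st'.
Proof.
move=> Ec sl; apply: stepsS => //; first by rewrite Ec.
by move=> fr; apply: fits_in_reg => //; case: fr.
Qed.

Lemma steps_store j l a x y l1 r M st' :
  ctl_code (b, l) = Store a x y (b, l1) -> safe_label l ->
  (s <= r x -> r y = 0) ->
  steps j l1 r (upd M a (upd (M a) (r x) (r y))) st' -> steps j.+1 l r M st'.
Proof.
move=> Ec sl sx; apply: stepsS => //; first by rewrite Ec.
by move=> fr; apply: fits_in_mem => //; case: fr.
Qed.

Lemma steps_branch j l x y l1 l2 r M st' :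
  ctl_code (b, l) = Branch _ x y (b, l1) (b, l2) -> safe_label l ->
  steps j (if r x < r y then l1 else l2) r M st' -> steps j.+1 l r M st'.
Proof. by move=> Ec sl; apply: stepsS => //; rewrite Ec /=; case: ifP. Qed.

(** A turn takes five instructions: test, fetch, store, two increments. The target index [RJ] starts
    at an arbitrary [J], so that the buffer can be appended to the certificate in the input
    array. *)
Lemma steps_copy_loop k r M K I J :
  r (sr ROne) = 1 -> r (copy_bound b k) = K -> r (sr RI) = I ->
  r (sr RJ) = J + I -> I <= K -> J + K <= s -> J + K < 2 ^ w ->
  exists r' M',
    [/\ steps (5 * (K - I) + 1) (Copy k CTest) r M (b, copy_exit k, r', M'),
        r' (sr RJ) = J + K,
        forall x, x \notin [:: sr RI; sr RJ; sr RX] -> r' x = r x,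
        forall a, a != copy_dst k -> M' a =1 M a
      & forall i, M' (copy_dst k) i =
          if J + I <= i < J + K then M (copy_src b k) (i - J)
          else M (copy_dst k) i].
Proof.
move=> one1 rK + + + Js Jw.
have nsd : copy_src b k != copy_dst k by case: (k); case: (b).
have nb : copy_bound b k \notin [:: sr RI; sr RJ; sr RX] by case: (k).
move: rK one1; move Ed : (K - I) => d.
elim: d I Ed r M => [|d IH] I Ed r M rK one1 rI rJ IK.
  have IK' : I = K by lia.
  exists r, M; split=> //.
  - apply: steps_branch => //; rewrite rI rK IK' ltnn; exact: steps0.
  - by rewrite rJ IK'.
  - by move=> i; rewrite IK'; case: ifP => //; lia.
set r1 := upd r (sr RX) (M (copy_src b k) I).
set M2 := upd M (copy_dst k) (upd (M (copy_dst k)) (J + I) (M (copy_src b k) I)).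
set r3 := upd r1 (sr RI) I.+1.
set r4 := upd r3 (sr RJ) (J + I.+1).
have fr4 x : x \notin [:: sr RI; sr RJ; sr RX] -> r4 x = r x.
  rewrite !inE !negb_or => /and3P[? ? ?].
  by rewrite /r4 upd_neq // /r3 upd_neq // /r1 upd_neq.
have [||||||r' [M' [st rJ' frr frM M'E]]] := IH I.+1 _ r4 M2.
- by lia.
- by rewrite fr4.
- by rewrite fr4.
- by rewrite /r4 upd_neq // /r3 upd_eq.
- by rewrite /r4 upd_eq.
- by lia.
exists r', M'; split=> //.
- have -> : 5 * d.+1 + 1 = (5 * d + 1).+4.+1 by lia.
  apply: steps_branch => //; rewrite rI rK.
  have -> : I < K by lia.
  apply: steps_fetch => //; rewrite rI -/r1.
  have r1J : r1 (sr RJ) = J + I by rewrite /r1 upd_neq.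
  have r1X : r1 (sr RX) = M (copy_src b k) I by rewrite /r1 upd_eq.
  have r1I : r1 (sr RI) = I by rewrite /r1 upd_neq.
  have r1o : r1 (sr ROne) = 1 by rewrite /r1 upd_neq.
  apply: steps_store => //; first by rewrite r1J; lia.
  rewrite r1J r1X -/M2.
  apply: steps_op => //; first by rewrite /= r1I r1o; lia.
  rewrite /= r1I r1o [I + 1]addn1 -/r3.
  have r3J : r3 (sr RJ) = J + I by rewrite /r3 upd_neq.
  have r3o : r3 (sr ROne) = 1 by rewrite /r3 upd_neq.
  apply: steps_op => //; first by rewrite /= r3J r3o; lia.
  by rewrite /= r3J r3o [_ + I + 1]addn1 -addnS -/r4.
- by move=> x xn; rewrite frr // fr4.
- by move=> a an i; rewrite frM // /M2 upd_neq.
- move=> i; rewrite M'E /M2 upd_eq (upd_neq _ _ nsd) /upd.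
  have [->|ni] := eqVneq i (J + I).
    by rewrite addnS ltnn /= leqnn addKn; case: ifP => //; lia.
  by congr (if _ then _ else _); lia.
Qed.

Lemma steps_copy k r M K J :
  r (sr ROne) = 1 -> r (copy_bound b k) = K -> r (sr RJ) = J ->
  J + K <= s -> J + K < 2 ^ w ->
  exists r' M',
    [/\ steps (5 * K + 2) (Copy k CInit) r M (b, copy_exit k, r', M'),
        r' (sr RJ) = J + K,
        forall x, x \notin [:: sr RI; sr RJ; sr RX] -> r' x = r x,
        forall a, a != copy_dst k -> M' a =1 M a
      & forall i, M' (copy_dst k) i =
          if J <= i < J + K then M (copy_src b k) (i - J)
          else M (copy_dst k) i].
Proof.
move=> one1 rK rJ Js Jw; set r0 := upd r (sr RI) 0.
have rK0 : r0 (copy_bound b k) = K by rewrite /r0 upd_neq //; case: (k).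
have rI0 : r0 (sr RI) = 0 by rewrite /r0 upd_eq.
have rJ0 : r0 (sr RJ) = J + 0 by rewrite /r0 upd_neq // addn0.
have one0 : r0 (sr ROne) = 1 by rewrite /r0 upd_neq.
have [r' [M' [st rJ' frr frM M'E]]] :=
  steps_copy_loop M one0 rK0 rI0 rJ0 (leq0n K) Js Jw.
exists r', M'; split=> //.
- have -> : 5 * K + 2 = (5 * (K - 0) + 1).+1 by lia.
  by apply: steps_const => //; lia.
- move=> x xn; rewrite frr // /r0 upd_neq //.
  by move: xn; rewrite inE negb_or => /andP[].
- by move=> i; rewrite M'E addn0.
Qed.

Lemma steps_clear_row r M j : j <= #|arr p| -> r (sr RZero) = 0 ->
  exists M',
    [/\ steps (#|arr p| - j) (ClearArr (inord j)) r M
          (b, ClearArr (inord #|arr p|), r, M'),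
        forall a i, M' (inl a) i =
          if (j <= index a (enum (arr p))) && (i == r (sr RI)) then 0
          else M (inl a) i
      & forall c, M' (inr c) =1 M (inr c)].
Proof.
move=> + z0; move Ed : (#|arr p| - j) => d.
elim: d j Ed M => [|d IH] j Ed M jN.
  have -> : j = #|arr p| by lia.
  exists M; split=> // a i.
  by rewrite cardT leqNgt index_mem mem_enum.
have jN' : j < #|arr p| by lia.
set aj := nth (inp p) (enum (arr p)) j.
set M1 := upd M (inl aj) (upd (M (inl aj)) (r (sr RI)) 0).
have [||M' [st M'E frM]] := IH j.+1 _ M1; [by lia|by lia|].
exists M'; split=> //.
- apply: (steps_store (a := inl aj) (x := sr RI) (y := sr RZero)) => //.
    by rewrite /= inordK // jN'.
  by rewrite z0.
- move=> a i; rewrite M'E.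
  have Ea : (index a (enum (arr p)) == j) = (inl a == inl aj :> carr).
    apply/eqP/eqP => [Ej|[->]]; first by rewrite /aj -Ej nth_index ?mem_enum.
    by rewrite index_uniq ?enum_uniq // -cardT.
  rewrite [in RHS]leq_eqVlt [j == _]eq_sym Ea /M1 /upd.
  by case: (inl a =P inl aj) => [[<-]|_] /=; case: (i == _); rewrite ?andbF ?andbT //=; case: ifP.
Qed.

(** A cell index costs one test, one store per array and one increment, whence [#|arr p| + 2]. *)
Lemma steps_clear_loop r M I Lim :
  r (sr RZero) = 0 -> r (sr ROne) = 1 -> r (sr RLim) = Lim ->
  r (sr RI) = I -> I <= Lim -> Lim < 2 ^ w ->
  exists r' M',
    [/\ steps ((#|arr p| + 2) * (Lim - I) + 1) (Ctl ClearTest) r M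
          (b, ClearReg ord0, r', M'),
        forall x, x != sr RI -> r' x = r x,
        forall a i, M' (inl a) i = if I <= i < Lim then 0 else M (inl a) i
      & forall c, M' (inr c) =1 M (inr c)].
Proof.
move=> + + + + + Lw; move Ed : (Lim - I) => d.
elim: d I Ed r M => [|d IH] I Ed r M z0 one1 rL rI IL.
  exists r, M; split=> //.
  - rewrite muln0; apply: steps_branch => //; rewrite rI rL.
    by have -> : I < Lim = false by lia.
  - by move=> a i; case: ifP => //; lia.
have [|//|M1 [st1 M1E fr1]] := @steps_clear_row r M 0.
  by [].
set r1 := upd r (sr RI) I.+1.
have [||||||r' [M' [st frr M'E frM]]] := IH I.+1 _ r1 M1.
- by lia.
- by rewrite /r1 upd_neq.
- by rewrite /r1 upd_neq.
- by rewrite /r1 upd_neq.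
- by rewrite /r1 upd_eq.
- by lia.
exists r', M'; split=> //.
- have -> : (#|arr p| + 2) * d.+1 + 1 =
    (#|arr p| - 0 + ((#|arr p| + 2) * d + 1).+1).+1 by lia.
  apply: steps_branch => //; rewrite rI rL.
  have -> : I < Lim by lia.
  have -> : ord0 = inord 0 :> 'I_#|arr p|.+1 by apply: val_inj; rewrite /= inordK.
  apply: (steps_cat st1).
  apply: (steps_op (o := Add) (d := sr RI) (x := sr RI) (y := sr ROne)) => //.
  + by rewrite /= inordK // ltnn.
  + by rewrite /= rI one1; lia.
  + by rewrite /= rI one1 [I + 1]addn1.
- by move=> x xI; rewrite frr // /r1 upd_neq.
- move=> a i; rewrite M'E M1E rI /=.
  by case: eqP => [->|ne]; case: ifP; case: ifP => //; lia.
- by move=> c i; rewrite frM fr1.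
Qed.

Lemma steps_clear_regs r M j : j <= #|reg p| ->
  exists r',
    [/\ steps (#|reg p| - j).+1 (ClearReg (inord j)) r M (b, Ctl LoadK, r', M),
        forall x, r' (inl x) =
          if j <= index x (enum (reg p)) then 0 else r (inl x)
      & forall y, r' (inr y) = r (inr y)].
Proof.
move Ed : (#|reg p| - j) => d.
elim: d j Ed r => [|d IH] j Ed r jN.
  have -> : j = #|reg p| by lia.
  exists r; split=> // [|x].
    apply: (steps_branch (x := sr ROne) (y := sr ROne) (l1 := Ctl LoadK) (l2 := Ctl LoadK)) => //.
      by rewrite /= inordK // ltnn.
    by rewrite if_same.
  by rewrite cardT leqNgt index_mem mem_enum.
have jN' : j < #|reg p| by lia.
set xj := nth (rm p) (enum (reg p)) j.
set r1 := upd r (inl xj) 0.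
have [||r' [st r'E frr]] := IH j.+1 _ r1; [by lia|by lia|].
exists r'; split=> //.
- apply: (steps_const (d := inl xj) (k := 0)) => //; last exact: st.
    by rewrite /= inordK // jN'.
  by rewrite expn_gt0.
- move=> x; rewrite r'E.
  have Ex : (index x (enum (reg p)) == j) = (inl x == inl xj :> creg).
    apply/eqP/eqP => [Ej|[->]]; first by rewrite /xj -Ej nth_index ?mem_enum.
    by rewrite index_uniq ?enum_uniq // -cardT.
  rewrite [in RHS]leq_eqVlt [j == _]eq_sym Ex /r1 /upd.
  by case: (inl x =P inl xj) => /= _; case: ifP.
Qed.

(** * Simulation of the offline program *)

Definition simulates (c : config p n) (r : creg -> nat) (M : carr -> nat -> nat) :=
  (forall x, r (inl x) = rg c x) /\ (forall a, M (inl a) =1 Defs.mem c a).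

Lemma simulates_fits c (r r1 : creg -> nat) (M M1 : carr -> nat -> nat) :
  simulates c r1 M1 -> (forall y, r1 (inr y) = r (inr y)) ->
  (forall e, M1 (inr e) =1 M (inr e)) -> fits s w c ->
  fits_in s w r M -> fits_in s w r1 M1.
Proof.
move=> [sr1 sM1] fr fM [cr cM c0] [rr rM r0]; split.
- by case=> [x|y]; [rewrite sr1 | rewrite fr].
- by case=> [a|c1] i; [rewrite sM1 | rewrite fM].
- by case=> [a|c1] i si; [rewrite sM1 c0 | rewrite fM r0].
Qed.

Lemma exec_sim_code (c : config p n) r M :
  port c = None -> ~~ halted c -> simulates c r M ->
  exists r1 M1,
    [/\ exec (sim_code b (code (pc c))) (b, Sim (pc c), r, M) =
          (b, Sim (pc (step c)), r1, M1),
        simulates (step c) r1 M1, port (step c) = None,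
        forall y, r1 (inr y) = r (inr y) & forall e, M1 (inr e) =1 M (inr e)].
Proof.
case: c => l r0 M0 po /= -> {po}; rewrite /halted /= => + [/= sr0 sM0].
have updS d k k' : k = k' -> forall x, upd r (inl d) k (inl x) = upd r0 d k' x.
  by move=> -> x; rewrite /upd sr0.
case: (code l) => [d k l'|o d x y l'|d a x l'|a x y l'|x y l' l''|x y l1 l2 l3|//] _ /=.
- by exists (upd r (inl d) k), M; split=> //; split=> //=; exact: updS.
- eexists _, M; split=> //; split=> //=; apply: updS; by rewrite !sr0.
- eexists _, M; split=> //; split=> //=; apply: updS; by rewrite sr0 sM0.
- eexists r, _; split=> //; split=> //= a'; rewrite /upd /= !sr0.
  by move=> i; have [->|na] := eqVneq a' a; rewrite ?eqxx ?sM0 // (inj_eq (@inl_inj _ _)) (negbTE na) sM0.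
- by exists r, M; split=> //; rewrite !sr0; case: ifP.
- by exists r, M; split=> //; rewrite if_same.
Qed.

Lemma port_run_offline (lm : seq ('I_n * 'I_n)) i :
  port (run p lm (fun=> None) i) = None.
Proof.
elim: i => //= i; case: (run _ _ _ i) => l r M po /= ->.
by case: (code l).
Qed.

Lemma steps_sim (lm : seq ('I_n * 'I_n)) t i r M :
  let cp := run p lm (fun=> None) in
  (forall u, fits s w (cp u)) -> halted (cp t) -> i <= t ->
  simulates (cp i) r M ->
  exists j r' M',
    [/\ j <= (t - i).+1,
        steps j (Sim (pc (cp i))) r M (b, Ctl SaveC, r', M'),
        simulates (cp t) r' M',
        forall y, r' (inr y) = r (inr y) & forall e, M' (inr e) =1 M (inr e)].
Proof.
move=> cp fcp ht; have cpS u : cp u.+1 = step (cp u) by [].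
move Ed : (t - i) => d; elim: d i Ed r M => [|d IH] i Ed r M it sim.
  have Ei : i = t by lia.
  exists 1, r, M; split=> //; last by rewrite -Ei.
  move: ht; rewrite -Ei /halted => hc.
  apply: (steps_branch (x := sr ROne) (y := sr ROne) (l1 := Ctl SaveC) (l2 := Ctl SaveC)) => //.
    by rewrite /=; case: (code _) hc.
  by rewrite if_same.
have Ed' : t - i.+1 = d by lia.
have it' : i.+1 <= t by lia.
(* The offline run may halt before [t]. Its configuration is then frozen, and the simulation spends
   no instruction on the remaining indices. *)
have [hi|hi] := boolP (halted (cp i)).
  have Es : cp i.+1 = cp i.
    rewrite cpS; move: hi; rewrite /halted.
    by case: (cp i) => l0 r0 M0 p0 /=; case: (code l0).
  rewrite -Es in sim *.
  have [j [r' [M' [jd st sim' fr fM]]]] := IH _ Ed' _ _ it' sim.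
  by exists j, r', M'; split=> //; lia.
have [r1 [M1 [Ee sim1 _ fr1 fM1]]] := exec_sim_code (port_run_offline lm i) hi sim.
have [j [r' [M' [jd st sim' fr fM]]]] := IH _ Ed' _ _ it' sim1.
exists j.+1, r', M'; split=> //.
- apply: (stepsS (l1 := Sim (pc (step (cp i)))) (r1 := r1) (M1 := M1)) => //.
  apply: simulates_fits sim1 fr1 fM1 _.
  exact: (fcp i.+1).
- by move=> y; rewrite fr fr1.
- by move=> e k; rewrite fM fM1.
Qed.

(** The merged buffer is that of the opposite phase, which polls leave alone; reading and resetting
    it is therefore safe. *)
Lemma steps_round (cl bl cl' : seq ('I_n * 'I_n)) t r M :
  let cp := run p (cl ++ bl) (fun=> None) in
  s = KL * n -> 0 < n -> s < 2 ^ w -> 2 < 2 ^ w ->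
  (forall u, fits s w (cp u)) -> halted (cp t) ->
  rg (cp t) (rk p) = size cl' ->
  (forall i, i < 2 * size cl' -> Defs.mem (cp t) (out p) i = encode cl' i) ->
  2 * size (cl ++ bl) <= s -> 2 * size cl' <= s ->
  r (sr ROne) = 1 -> r (sr RZero) = 0 -> r (sr RN) = n ->
  r (sr RC) = size cl -> r (bufreg (~~ b)) = 2 * size bl ->
  (forall i, i < 2 * size cl -> M certarr i = encode cl i) ->
  (forall i, i < 2 * size bl -> M (bufarr (~~ b)) i = encode bl i) ->
  fits_in s w r M ->
  exists j r' M',
    [/\ j <= (#|arr p| + 17) * s + #|reg p| + t + 40,
        steps j (Ctl LoadLim) r M (b, Ctl Decide, r', M'),
        [/\ r' (sr ROne) = 1, r' (sr RZero) = 0, r' (sr RN) = n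
          & r' (sr RF) = r (sr RF)],
        r' (sr RC) = size cl' /\ r' (bufreg (~~ b)) = 0
      & forall i, i < 2 * size cl' -> M' certarr i = encode cl' i].
Proof.
move=> cp sE n0 sw w2 fcp ht rkE outE lms cls one1 z0 rN rC rB MC MB fr.
(* The registers that outlive the loops; none of them is an index or a bound of a loop. *)
pose kept := [:: sr ROne; sr RZero; sr RN; sr RF; sr RC; bufreg (~~ b)].
have keptP x : x \in kept ->
    x \notin [:: sr RI; sr RJ; sr RX; sr RK; sr RLim].
  by move: x; apply/allP.
have KLs : KL <= s by rewrite sE leq_pmulr.
set r1 := upd r (sr RLim) KL; set r2 := upd r1 (sr RLim) (KL * n).
set r3 := upd r2 (sr RI) 0.
have st3 : steps 3 (Ctl LoadLim) r M (b, Ctl ClearTest, r3, M).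
  apply: steps_const => //; first by apply: leq_ltn_trans sw.
  rewrite -/r1; have r1L : r1 (sr RLim) = KL by rewrite /r1 upd_eq.
  have r1N : r1 (sr RN) = n by rewrite /r1 upd_neq.
  apply: steps_op => //=; first by rewrite r1L r1N -sE.
  rewrite r1L r1N -/r2; apply: steps_const => //; first by rewrite expn_gt0.
have k3 x : x \in kept -> r3 x = r x.
  move/keptP; rewrite !inE !negb_or => /and5P[? ? ? ? ?].
  by rewrite /r3 upd_neq // /r2 upd_neq // /r1 upd_neq.
have [one3 z3] : r3 (sr ROne) = 1 /\ r3 (sr RZero) = 0 by rewrite !k3.
have L3 : r3 (sr RLim) = s by rewrite /r3 upd_neq // /r2 upd_eq.
have I3 : r3 (sr RI) = 0 by rewrite /r3 upd_eq.
have [r4 [M4 [st4 f4 M4E M4B]]] :=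
  steps_clear_loop M z3 one3 L3 I3 (leq0n s) sw.
have {}M4E a i : M4 (inl a) i = 0.
  by rewrite M4E /=; case: ltnP => //; case: fr => _ _; apply.
have k4 x : x \in kept -> r4 x = r x.
  move=> xk; rewrite f4 ?k3 //; move/keptP: xk.
  by rewrite inE negb_or => /andP[].
have [r5 [st5 r5E r5B]] := @steps_clear_regs r4 M4 0 (leq0n _).
have k5 x : x \in kept -> r5 x = r x.
  by move=> xk; rewrite -k4 //; case: x xk => // x _; rewrite r5B.
have C5 : r5 (sr RC) = size cl by rewrite k5.
set r6 := upd r5 (sr RK) (2 * size cl); set r7 := upd r6 (sr RJ) 0.
have szs : 2 * size cl + 2 * size bl <= s by rewrite -mulnDr -size_cat.
have st7 : steps 2 (Ctl LoadK) r5 M4 (b, Copy CertToInp CInit, r7, M4).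
  apply: steps_op => //=; first by rewrite C5; lia.
  rewrite C5 addnn -mul2n -/r6.
  by apply: steps_const => //; rewrite expn_gt0.
have k7 x : x \in kept -> r7 x = r x.
  move=> xk; rewrite -k5 //; move/keptP: xk.
  rewrite !inE !negb_or => /and5P[? ? ? ? ?].
  by rewrite /r7 upd_neq // /r6 upd_neq.
have one7 : r7 (sr ROne) = 1 by rewrite k7.
have K7 : r7 (copy_bound b CertToInp) = 2 * size cl.
  by rewrite /r7 upd_neq // /r6 upd_eq.
have J7 : r7 (sr RJ) = 0 by rewrite /r7 upd_eq.
have [||r8 [M8 [st8 J8 f8 g8 M8E]]] := steps_copy M4 one7 K7 J7; try by lia.
have k8 x : x \in kept -> r8 x = r x.
  move=> xk; rewrite f8 ?k7 //; move/keptP: xk.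
  by rewrite !inE !negb_or => /and5P[-> -> -> _ _].
have one8 : r8 (sr ROne) = 1 by rewrite k8.
have K8 : r8 (copy_bound b BufToInp) = 2 * size bl.
  by rewrite k8 // !inE eqxx !orbT.
have [||r9 [M9 [st9 J9 f9 g9 M9E]]] := steps_copy M8 one8 K8 J8; try by lia.
have k9 x : x \in kept -> r9 x = r x.
  move=> xk; rewrite f9 ?k8 //; move/keptP: xk.
  by rewrite !inE !negb_or => /and5P[-> -> -> _ _].
have z9 x : r9 (inl x) = 0.
  by rewrite f9 // f8 // /r7 upd_neq // /r6 upd_neq // r5E.
have M9z a i : a != inp p -> M9 (inl a) i = 0.
  move=> ai; have ai' : (inl a : carr) != inl (inp p) by [].
  by rewrite g9 // g8 // M4E.
(* A fresh start requires the whole array to match, beyond the end of the list too: there the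
   clearing supplies the default 0 of [encode]. *)
have M9i i : M9 (inl (inp p)) i = encode (cl ++ bl) i.
  rewrite encode_cat M9E M8E /= add0n M4E.
  have [icl|icl] := ltnP i (2 * size cl); first by rewrite andFb subn0 M4B MC.
  rewrite andTb; have [ibl|ibl] := ltnP.
    by rewrite g8 // M4B MB //; lia.
  by rewrite encode_default //; lia.
set r10 := upd r9 (sr RX) 2; set r11 := upd r10 (inl (rm p)) (size (cl ++ bl)).
set r12 := upd r11 (inl (rn p)) n; set r13 := upd r12 (bufreg (~~ b)) 0.
have n2w : n < 2 ^ w by rewrite -rN; case: fr.
have st13 : steps 4 (Ctl LoadTwo) r9 M9 (b, Sim (start p), r13, M9).
  apply: steps_const => //; rewrite -/r10.
  have J10 : r10 (sr RJ) = 2 * size (cl ++ bl).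
    by rewrite /r10 upd_neq // J9 size_cat mulnDr.
  have X10 : r10 (sr RX) = 2 by rewrite /r10 upd_eq.
  have E10 : r10 (sr RJ) %/ r10 (sr RX) = size (cl ++ bl).
    by rewrite J10 X10 mulKn.
  apply: steps_op => //=; first by rewrite E10; lia.
  rewrite E10 -/r11.
  have E11 : r11 (sr RN) + r11 (sr RZero) = n.
    by rewrite /r11 !upd_neq // /r10 !upd_neq // !k9 // rN z0 addn0.
  apply: steps_op => //=; first by rewrite E11.
  rewrite E11 -/r12.
  by apply: steps_const => //; rewrite expn_gt0.
have k13 x : x \in kept -> x != bufreg (~~ b) -> r13 x = r x.
  move=> xk xb; rewrite -k9 // /r13 upd_neq //; move: (keptP _ xk).
  rewrite !inE !negb_or => /and5P[_ _ xX _ _].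
  by case: x xk xb xX => // x _ _ xX; rewrite /r12 upd_neq // /r11 upd_neq // /r10 upd_neq.
have sim0 : simulates (cp 0) r13 M9.
  split=> [x|a i] /=.
    rewrite /r13 upd_neq // /r12 /r11 /r10 /upd /= z9.
    by [].
  rewrite /upd; have [->|ai] := eqVneq a (inp p); first exact: M9i.
  exact: M9z.
have [j [r14 [M14 [jt st14 sim14 f14 g14]]]] := steps_sim fcp ht (leq0n t) sim0.
have k14 y : inr y \in kept -> inr y != bufreg (~~ b) -> r14 (inr y) = r (inr y).
  by move=> yk yb; rewrite f14 k13.
set r15 := upd r14 (sr RC) (size cl').
set r16 := upd r15 (sr RK) (2 * size cl'); set r17 := upd r16 (sr RJ) 0.
have st17 : steps 3 (Ctl SaveC) r14 M14 (b, Copy OutToCert CInit, r17, M14).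
  have E14 : r14 (inl (rk p)) + r14 (sr RZero) = size cl'.
    by rewrite k14 // z0 addn0; case: sim14 => -> _.
  apply: steps_op => //=; first by rewrite E14; lia.
  rewrite E14 -/r15; have C15 : r15 (sr RC) = size cl' by rewrite /r15 upd_eq.
  apply: steps_op => //=; first by rewrite C15; lia.
  rewrite C15 addnn -mul2n -/r16.
  by apply: steps_const => //; rewrite expn_gt0.
have f17 x : x \notin [:: sr RC; sr RK; sr RJ] -> r17 x = r14 x.
  rewrite !inE !negb_or => /and3P[? ? ?].
  by rewrite /r17 upd_neq // /r16 upd_neq // /r15 upd_neq.
have one17 : r17 (sr ROne) = 1 by rewrite f17 // k14.
have K17 : r17 (copy_bound b OutToCert) = 2 * size cl'.
  by rewrite /r17 upd_neq // /r16 upd_eq.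
have J17 : r17 (sr RJ) = 0 by rewrite /r17 upd_eq.
have [||r18 [M18 [st18 _ f18 _ M18E]]] := steps_copy M14 one17 K17 J17; try by lia.
have o1 : ord0 = inord 0 :> 'I_#|reg p|.+1 by apply: val_inj; rewrite /= inordK.
rewrite o1 in st4.
have st := steps_cat st3 (steps_cat st4 (steps_cat st5 (steps_cat st7
  (steps_cat st8 (steps_cat st9 (steps_cat st13 (steps_cat st14
  (steps_cat st17 st18)))))))).
exists (3 + ((#|arr p| + 2) * (s - 0) + 1 + ((#|reg p| - 0).+1 + (2 +
  (5 * (2 * size cl) + 2 + (5 * (2 * size bl) + 2 + (4 + (j +
  (3 + (5 * (2 * size cl') + 2)))))))))), r18, M18; split.
(* Clearing costs [#|arr p| + 2] per cell. The two copies to the input cost at most [5 * s]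
   together, and so does the copy of the output; the stated constants leave some slack. *)
- move: (jt) szs cls; rewrite !subn0 mulnDl [in X in _ -> _ -> _ -> _ <= X]mulnDl.
  by lia.
- exact: st.
- by rewrite !f18 // !f17 // !k14.
- rewrite f18 // /r17 upd_neq // /r16 upd_neq // /r15 upd_eq; split=> //.
  by rewrite f18 // f17 // f14 /r13 upd_eq.
- move=> i icl; rewrite M18E /= add0n icl subn0.
  by case: sim14 => _ ->; exact: outE.
Qed.

End Phase.
End Control.

(** * Correctness of the streaming algorithm *)

Section Streaming.

Variables (P : forall n, mgraph n -> Prop) (p : program) (KL c n s w fm T : nat).

(** The offline guarantee at a fixed [n], with bounds [s], [w] and [fm] common to all inputs that a
    round can have. *)
Definition offline_run (lm : seq ('I_n * 'I_n)) : Prop :=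
  (forall u, fits s w (run p lm (fun=> None) u)) /\
  exists t cl', let cp := run p lm (fun=> None) t in
    [/\ t <= fm /\ halted cp, rg cp (rk p) = size cl',
        forall i, i < 2 * size cl' -> Defs.mem cp (out p) i = encode cl' i,
        loopless cl' /\ size cl' <= c * n
      & strong_certificate P (list_graph lm) (list_graph cl')].

Hypothesis offline : forall lm : seq ('I_n * 'I_n),
  loopless lm -> size lm <= c.+2 * n -> offline_run lm.
Hypotheses (sE : s = KL * n) (n0 : 0 < n) (sw : s < 2 ^ w).
Hypotheses (cs : 2 * (c.+2 * n) <= s) (ns : 2 * n + 4 <= s) (T6 : 6 <= T).
Hypothesis nT : 6 * ((#|arr p| + 17) * s + #|reg p| + fm + 50) <= n * T.

Variables (l : seq ('I_n * 'I_n)) (tau : nat -> nat).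
Hypotheses (nl : loopless l) (tauT : spaced T tau).

Let q := streamer p KL.

Variable conf : nat -> config q n.
Hypothesis conf0 : conf 0 = init q [::].
Hypothesis confS : forall t,
  conf t.+1 = step (arrive (stream_arrivals l tau t) (conf t)).

Local Notation Cfg := (@Config q n).
Local Notation sr := (sr p).

Lemma fits_until t t1 t2 : t <= t1 ->
  (forall i, t <= i <= t1 -> fits s w (conf i)) ->
  (forall i, t1 <= i <= t2 -> fits s w (conf i)) ->
  forall i, t <= i <= t2 -> fits s w (conf i).
Proof.
move=> tt1 f1 f2 i ti; have [it1|t1i] := leqP i t1; first by apply: f1; lia.
by apply: f2; lia.
Qed.

(* The beginning of a round of phase [b]: [k] events have been received; the
   stored certificate [cl] covers the first [k0] edges, and buffer [~~ b] holds
   the edges between [k0] and [k]. *)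
Record entry (b : bool) (t k k0 : nat) (cl : seq ('I_n * 'I_n)) (F : bool)
    (r : reg q -> nat) (M : arr q -> nat -> nat) : Prop := Entry {
  entry_conf : conf t = Cfg ((b, Ctl p LoadLim), Poll) r M (portat l tau t k);
  entry_clock : clock l tau t k;
  entry_k0 : k0 <= k <= k0 + n.+1;
  entry_one : r (sr ROne) = 1;
  entry_zero : r (sr RZero) = 0;
  entry_n : r (sr RN) = n;
  entry_end : r (sr RE) = (size l < k);
  entry_final : r (sr RF) = F;
  entry_buf : r (bufreg p b) = 0;
  entry_C : r (sr RC) = size cl;
  entry_cert : forall i, i < 2 * size cl -> M (certarr p) i = encode cl i;
  entry_tl : r (bufreg p (~~ b)) = 2 * size (slice l k0 k);
  entry_edges : forall i, i < 2 * size (slice l k0 k) ->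
    M (bufarr p (~~ b)) i = encode (slice l k0 k) i;
  entry_loopless : loopless cl;
  entry_size : size cl <= c * n;
  entry_sound : strong_certificate P (list_graph (take k0 l)) (list_graph cl);
  entry_finalP : F -> size l < k;
  entry_finalE : size l < k0 -> F;
  entry_fits : fits_in s w r M
}.

Definition finished (t : nat) : Prop :=
  halted (conf t) /\
  exists G', [/\ outputs (conf t) G', num_edges G' <= c * n
    & strong_certificate P (list_graph l) G'].

Lemma loopless_slice k0 k : loopless (slice l k0 k).
Proof.
by apply/allP => e /mem_drop /mem_take; move: e; apply/allP.
Qed.

Lemma take_slice k0 k : k0 <= k -> take k0 l ++ slice l k0 k = take k l.
Proof.
by move=> h; rewrite -[RHS](cat_take_drop k0) take_takel.
Qed.

Lemma round b t k k0 cl F r M : entry b t k k0 cl F r M ->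
  exists t', [/\ t < t', forall i, t <= i <= t' -> fits s w (conf i)
    & if F then finished t'
      else exists k' cl' F' r' M', entry (~~ b) t' k' k cl' F' r' M'].
Proof.
case=> Et ck /andP[k0k kk0] one1 z0 rN rE rF rb rC MC rtl MB ncl scl sound FP FE fr.
set bl := slice l k0 k.
have szb : size bl <= n.+1 by have := size_slice l k0 k; rewrite -/bl; lia.
(* The certificate has at most [c * n] edges and the buffer at most [n.+1 <= 2 * n]: hence
   [c.+2]. *)
have szl : size (cl ++ bl) <= c.+2 * n by rewrite size_cat; lia.
have nlm : loopless (cl ++ bl).
  by rewrite /loopless all_cat; apply/andP; split=> //; exact: loopless_slice.
have [fcp [t0 [cl' /= [[t0f ht] rkE outE [ncl' scl'] cert']]]] := offline nlm szl.
have w2 : 2 < 2 ^ w by lia.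
have n2w : n < 2 ^ w by lia.
have n2w4 : 2 * n + 4 < 2 ^ w by lia.
have szl' : 2 * size (cl ++ bl) <= s by lia.
have scl2 : 2 * size cl' <= s by lia.
have [j [r0 [M0 [jD st0 [one0 z00 rN0 rF0] [rC0 rb0] MC0]]]] :=
  steps_round sE n0 sw w2 fcp ht rkE outE szl' scl2 one1 z0 rN rC rtl MC MB fr.
have sound' : strong_certificate P (list_graph (take k l)) (list_graph cl').
  apply: strong_certificate_trans cert'.
  by rewrite -(take_slice k0k) !list_graph_cat; exact: strong_certificate_union.
pose lt : clab p := if F then Ctl p Stop else Ctl p LatchEnd.
have st1 : steps KL s w b 1 (Ctl p Decide) r0 M0 (b, lt, r0, M0).
  apply: steps_branch => //; rewrite one0 rF0 rF ltnS leqn0 eqb0 /lt.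
  by case: (F).
have [re fe] := steps_cat st0 st1 fr.
have bk : buffered (@bufreg_of p) (@buf_of p) (sr RE) l k k (b, Ctl p Decide) r M.
  have s0 : slice l k k = [::].
    by apply/size0nil; apply/eqP; rewrite -leqn0 -(subnn k) size_slice.
  by split=> //; rewrite s0.
(* The added instruction is [Decide]. The slack in [nT] also pays for the latch and the change of
   phase below. *)
have tD : t + 6 * (j + 1) <= t + n * T by lia.
have ag : agree (@bufreg_of p) (@buf_of p) (sr RU) (sr RV) (sr RE) (b, Ctl p Decide) r M r M.
  by [].
have [t1 [k1 [r1 [M1 [tt1 [E1 ck1] [one11 ag1] b1 [kk1 fi1]]]]]] :=
  reach_conf (@streamer_pollregs_uniq p) tauT T6 confS n2w ns n2w4
    ck re Et ck (leqnn k) tD one1 ag bk fr.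
have f1 : fits_in s w r1 M1 by have := fi1 t1; rewrite E1; apply; lia.
have tn1 : t1 <= t + n * T by lia.
case: ag1 => ar1 aM1; rewrite /volatile /= in ar1 aM1.
have nb : bufreg p (~~ b) \notin [:: sr RU; sr RV; sr RE; bufreg p b].
  by case: (b).
have [t2 [k2 [r2 [M2 [tt2 E2 [ck2 ck2'] [b2 [ar2 aM2]] [kk2 fi2]]]]]] :=
  poll_in_time (@streamer_pollregs_uniq p) tauT T6 confS n2w ns n2w4
    E1 ck1 ck kk1 tn1 one11 b1 f1.
rewrite /volatile /= in ar2 aM2.
have rC2 : r2 (sr RC) = size cl' by rewrite ar2 // ar1.
have MC2 i : i < 2 * size cl' -> M2 (certarr p) i = encode cl' i.
  by move=> icl; rewrite aM2 // aM1 // MC0.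
have tt2' : t <= t1 by lia.
have fi12 := fits_until tt2' fi1 fi2.
move: E1 E2; rewrite /lt; case: (F) FP => FP E1 E2.
  (* [Stop] is polled as well, so the machine halts only at its stage [Exec]. As [F] implies that
     the end was received before the round, [take k l] is all of [l]. *)
  exists t2; split=> //; first by lia.
  split; first by rewrite E2.
  exists (list_graph cl'); split.
  - exists cl'; split; first exact: edge_list_list_graph.
      by rewrite E2.
    by rewrite E2.
  - by rewrite num_edges_list_graph.
  - by have := sound'; rewrite take_oversize // ltnW // FP.
(* The latch comes before the change of phase, and a poll may intervene. If the latched flag is set,
   no edge can follow; if not, a late end is latched one round later. *)
have E3 := conf_exec tauT T6 confS E2 ck2 isT.
rewrite /= in E3; set r3 := upd r2 _ _ in E3.
have [_ _ rE2] := b2.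
have RF3 : r3 (sr RF) = (size l < k2).
  by rewrite /r3 upd_eq rE2 ar2 // ar1 // z00 addn0.
have f2 : fits_in s w r2 M2 by have := fi2 t2; rewrite E2; apply; lia.
have f3 : fits_in s w r3 M2.
  apply: fits_in_reg => //; rewrite rE2 ar2 // ar1 // z00 addn0.
  by apply: leq_ltn_trans (leq_b1 _) _; lia.
have one3 : r3 (sr ROne) = 1 by rewrite /r3 upd_neq // ar2.
have b3 : buffered (@bufreg_of p) (@buf_of p) (sr RE) l k k2
    (b, Ctl p SwitchPhase) r3 M2.
  by case: b2 => ? ? ?; split=> //; rewrite /r3 upd_neq.
have kk2' : k <= k2 by lia.
have tn3 : t2.+1 <= t + n * T by lia.
have [t4 [k4 [r4 [M4 [tt4 E4 [ck4 ck4'] [b4 [ar4 aM4]] [kk4 fi4]]]]]] :=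
  poll_in_time (@streamer_pollregs_uniq p) tauT T6 confS n2w ns n2w4
    E3 ck2' ck kk2' tn3 one3 b3 f3.
rewrite /volatile /= in ar4 aM4.
have E5 := conf_exec tauT T6 confS E4 ck4 isT.
rewrite /= in E5; set r5 := upd r4 _ _ in E5.
have f4 : fits_in s w r4 M4 by have := fi4 t4; rewrite E4; apply; lia.
have f5 : fits_in s w r5 M4 by apply: fits_in_reg => //; lia.
exists t4.+1; split; first by lia.
  have tt3 : t <= t2.+1 by lia.
  have fi123 : forall i, t <= i <= t2.+1 -> fits s w (conf i).
    apply: (fits_until (t1 := t2)) => //; first by lia.
    move=> i ti; have [->|->] : i = t2 \/ i = t2.+1 by lia.
      by apply: fi2; lia.
    by rewrite E3.
  have fi1234 := fits_until tt3 fi123 fi4.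
  move=> i ti; have [it4|it4] := leqP i t4; first by apply: fi1234; lia.
  have -> : i = t4.+1 by lia.
  by rewrite E5.
exists k4, cl', (size l < k2), r5, M4.
have tn5 : t4 <= t + n * T by lia.
have kk4' : k <= k4 by lia.
have kn := clock_bound tauT T6 ck ck4 kk4' tn5.
have [btl bM bE] := b4.
split=> //.
- by rewrite kk4'.
- by rewrite /r5 upd_neq // ar4.
- by rewrite /r5 upd_neq // ar4 // /r3 upd_neq // ar2 // ar1.
- by rewrite /r5 upd_neq // ar4 // /r3 upd_neq // ar2 // ar1.
- by rewrite /r5 upd_neq // ar4.
- by rewrite /r5 upd_neq // ar4 // /r3 upd_neq // ar2 // ar1.
- by rewrite /r5 upd_neq // ar4 // /r3 upd_neq.
- by move=> i icl; rewrite aM4 // MC2.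
- by rewrite negbK /r5 upd_neq.
- by rewrite negbK.
- by move=> lk2; apply: leq_trans lk2 _; lia.
- by move=> lk; apply: leq_trans lk _; lia.
Qed.

(** Event [(size l).+1] does not exist, but [tau] gives it a time, and no earlier event can still be
    pending then. *)
Lemma clock_end t k : clock l tau t k -> tau (size l).+1 <= t -> size l < k.
Proof.
move=> [_ _ late] te; rewrite ltnNge; apply/negP => kl.
have kl1 : k.+1 <= (size l).+1 by [].
by have := leq_trans (leq_addr _ _) (spaced_le tauT T6 kl1); have := late kl; lia.
Qed.

Lemma entry_start :
  exists r M, entry false 1 0 0 [::] false r M /\ fits s w (conf 0).
Proof.
have E0 : conf 0 = Cfg ((false, Ctl p SetOne), Exec) (rg (init (n := n) q [::]))
    (Defs.mem (init (n := n) q [::])) (portat l tau 0 0).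
  by rewrite conf0 /portat ltn0 andbF.
have t1 := tauT 0.
have ck0 : clock l tau 0 0 by split=> // _; lia.
have E1 := conf_exec tauT T6 confS E0 ck0 isT; rewrite /= in E1.
set r := upd _ (sr ROne) 1 in E1; set M := upd _ _ _ in E1.
have M0 a i : M a i = 0 by rewrite /M /upd; case: ifP => // _; rewrite encode_default.
have r0 x : r x < 2 ^ w by rewrite /r /upd; do !case: ifP => _ //=; lia.
have fr : fits_in s w r M.
  by split=> [//|a i|a i _]; rewrite M0 // expn_gt0.
exists r, M; split; last first.
  rewrite conf0; split=> /= [x|a i|a i _].
  - by rewrite /upd; do !case: ifP => _ //=; lia.
  - by rewrite -/M M0 expn_gt0.
  - by rewrite -/M M0.
split=> //.
- by split=> // _; lia.
- by rewrite /slice take0.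
- by move=> i; rewrite /slice take0.
- by rewrite take0.
Qed.

(** Every round takes at least one step, so rounds go past any prescribed time unless the machine
    finishes before. *)
Lemma rounds d :
  exists t, (forall i, i <= t -> fits s w (conf i)) /\
  (finished t \/
   d <= t /\ exists b k k0 cl F r M, entry b t k k0 cl F r M).
Proof.
elim: d => [|d [t [ft [fin|[dt [b [k [k0 [cl [F [r [M en]]]]]]]]]]]].
- have [r [M [en f0]]] := entry_start; exists 1; split=> [[|[|//]] _ //|].
    by rewrite (entry_conf en); exact: entry_fits en.
  by right; split=> //; exists false, 0, 0, [::], false, r, M.
- by exists t; split=> //; left.
have [t' [tt' ft' fin]] := round en.
exists t'; split=> [i it'|].
  by have [it|ti] := leqP i t; [apply: ft | apply: ft'; lia].
case: F en fin => en fin; first by left.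
by right; split; [lia | case: fin => k' [cl' [F' [r' [M' en']]]]; exists (~~ b), k', k, cl', F', r', M'].
Qed.

Lemma finished_halts t : finished t -> (forall i, i <= t -> fits s w (conf i)) ->
  forall i, fits s w (conf i).
Proof.
move=> [ht _] ft i; have [/ft//|/ltnW ti] := leqP i t.
(* The port is left out, since [arrive] may write to it even after the machine has halted. *)
suff : [/\ pc (conf i) = pc (conf t), rg (conf i) = rg (conf t)
    & Defs.mem (conf i) = Defs.mem (conf t)].
  by move=> [_ Er EM]; rewrite /fits Er EM; exact: ft.
rewrite -(subnKC ti); elim: (i - t) => [|d]; first by rewrite addn0.
rewrite addnS confS; move: ht; rewrite /halted.
case: (conf (t + d)) => l0 r0 M0 p0 /= + [pE rE ME]; rewrite -pE -rE -ME.
by case: (stream_arrivals _ _ _) => [ev|] /=; case: (polled_code _ _ _ _ _ _ _ _).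
Qed.

Theorem streamer_correct :
  (forall t, fits s w (conf t)) /\ exists t, finished t.
Proof.
suff [t [fin ft]] : exists t, finished t /\ forall i, i <= t -> fits s w (conf i).
  by split; [exact: finished_halts fin ft | exists t].
have [t [ft [fin|[dt [b [k [k0 [cl [F [r [M en]]]]]]]]]]] := rounds (tau (size l).+1).
  by exists t.
have lk := clock_end (entry_clock en) dt.
have [t1 [tt1 ft1 fin]] := round en.
have {}ft1 i : i <= t1 -> fits s w (conf i).
  by move=> it1; have [it|ti] := leqP i t; [apply: ft | apply: ft1; lia].
case: F en fin => en fin; first by exists t1.
case: fin => k' [cl' [F' [r' [M' en']]]].
(* The end was received before the preceding round began, hence was latched by its end: this second
   round is the last one. *)
have [t2 [tt2 ft2 fin]] := round en'.
rewrite (entry_finalE en' lk) in fin.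
exists t2; split=> // i it2.
by have [it|ti] := leqP i t1; [apply: ft1 | apply: ft2; lia].
Qed.

End Streaming.

(** * Resource bounds *)

Lemma bitlen_gt x : x < 2 ^ bitlen x.
Proof. exact: trunc_log_ltn. Qed.

Lemma bitlen_le x k : 0 < k -> x < 2 ^ k -> bitlen x <= k.
Proof.
case: x => [|x] k0 xk; first by rewrite /bitlen trunc_log0.
by rewrite -(ltn_exp2l _ _ (isT : 1 < 2)); apply: leq_ltn_trans xk; exact: trunc_logP.
Qed.

Lemma mul_lt_exp2_bitlen K n : K * n < 2 ^ (K.+1 * bitlen n).
Proof.
have h : K + bitlen n <= K.+1 * bitlen n.
  by rewrite mulSn addnC leq_add2l leq_pmulr.
apply: leq_trans (leq_pexp2l (isT : 0 < 2) h); rewrite expnD.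
by apply: ltn_mul; [exact: ltn_expl | exact: bitlen_gt].
Qed.

Lemma fits_leq p n s1 w1 s2 w2 (cf : config p n) :
  s1 <= s2 -> w1 <= w2 -> fits s1 w1 cf -> fits s2 w2 cf.
Proof.
move=> s12 w12 [fr fM f0]; have e12 := leq_pexp2l (isT : 0 < 2) w12.
split=> [x|a i|a i si]; first exact: leq_trans (fr x) e12.
  exact: leq_trans (fM a i) e12.
by apply: f0; exact: leq_trans si.
Qed.

Definition worst_size (f : nat -> nat -> nat) (K n : nat) : nat :=
  [arg max_(i > ord0 : 'I_(K * n).+1) f n i].

Lemma worst_size_le f K n : worst_size f K n <= K * n.
Proof. by rewrite -ltnS ltn_ord. Qed.

Lemma worst_sizeP f K n m : m <= K * n -> f n m <= f n (worst_size f K n).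
Proof.
rewrite /worst_size -ltnS => mK; case: arg_maxnP => // i _ /(_ (Ordinal mK)).
exact.
Qed.

(** With [m <= c.+2 * n] and [0 < n], both [c * m.+1] and [n + m] are at most [c.+3 * c.+3 * n].
    This one bound serves for the space and for the word length. *)
Lemma offline_run_sparse (P : forall n, mgraph n -> Prop) f p c n
    (lm : seq ('I_n * 'I_n)) :
  (forall (H : mgraph n) (l : seq ('I_n * 'I_n)), edge_list H l ->
    let m := num_edges H in
    let conf := run p l (fun=> None) in
    (forall t, fits (c * m.+1) (c * bitlen (n + m)) (conf t)) /\
    exists t H',
      [/\ t <= f n m, halted (conf t), outputs (conf t) H',
          num_edges H' <= c * n & strong_certificate P H H']) ->
  0 < n -> loopless lm -> size lm <= c.+2 * n ->
  let KL := c.+3 * c.+3 in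
  offline_run P p c (KL * n) (c.+1 * (KL.+1 * bitlen n))
    (f n (worst_size f c.+2 n)) lm.
Proof.
move=> hp n0 nlm szl KL; have := hp _ _ (edge_list_list_graph nlm).
rewrite /= (num_edges_list_graph nlm) => -[fi [t [H' [tf ht [cl' [el szE outE]] nH cH]]]].
have nKL : n + size lm <= KL * n by rewrite /KL; nia.
split=> [u|].
  apply: fits_leq (fi u); first by rewrite /KL; nia.
  apply: leq_mul => //; apply: bitlen_le; first by rewrite muln_gt0.
  exact: leq_ltn_trans nKL (mul_lt_exp2_bitlen _ _).
have [ncl HE] := edge_list_graphE el.
exists t, cl'; split=> //.
- by split=> //; apply: leq_trans tf _; exact: worst_sizeP.
- by split=> //; rewrite -num_edges_list_graph // -HE.
- by rewrite -HE.
Qed.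

Lemma round_time_bound A R K n F X : 0 < n -> n <= X -> F <= X ->
  6 * ((A + 17) * (K * n) + R + F + 50) <= 6 * ((A + 17) * K + R + 51) * X.
Proof.
move=> n0 nX FX; have X0 : 0 < X by apply: leq_trans nX.
have h1 : R <= R * X by rewrite leq_pmulr.
have h2 : (A + 17) * K * n <= (A + 17) * K * X by rewrite leq_mul2l nX orbT.
rewrite mulnA -[leqRHS]mulnA leq_mul2l /= !(mulnDl _ _ X); lia.
Qed.

Theorem theorem1 (P : forall n : nat, mgraph n -> Prop) (f : nat -> nat -> nat) :
  (exists p : program, computes_sparse_certificates P f p) ->
  exists (q : program) (g T : nat -> nat),
    [/\ isO g (fun n => n),
        isO T (fun n => (f n (g n) %/ n).+1)
      & streams_sparse_certificates P T q].
Proof.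
move=> [p [c hp]]; pose KL := c.+3 * c.+3; pose q := streamer p KL.
pose g := worst_size f c.+2.
(* Six steps per instruction; 51 is the additive constant 50 of a round plus the coefficient 1 of
   [f]. *)
pose C := 6 * ((#|arr p| + 17) * KL + #|reg p| + 51).
exists q, g, (fun n => C * (f n (g n) %/ n).+1); split.
- by exists c.+2 => n _; exact: worst_size_le.
- by exists C.
pose c' := (#|arr q| * KL + #|reg q|) * (c.+1 * KL.+1) + up_log 2 #|lab q| + c.
(* A single logarithmic factor: O(n) words of O(log n) bits. *)
exists c', 1 => n n0; exists (KL * n), (c.+1 * (KL.+1 * bitlen n)).
have b0 : 0 < n * bitlen n by rewrite muln_gt0 n0.
split=> [|G l tau el sp conf].
  rewrite expn1 /bits; set a := #|arr q|; set r := #|reg q|; set u := up_log _ _.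
  have h1 : (a * (KL * n) + r) * (c.+1 * (KL.+1 * bitlen n)) <=
      (a * KL + r) * (c.+1 * KL.+1) * (n * bitlen n).
    have -> : (a * KL + r) * (c.+1 * KL.+1) * (n * bitlen n) =
      (a * KL + r) * n * (c.+1 * (KL.+1 * bitlen n)) by lia.
    by apply: leq_mul => //; rewrite [leqRHS]mulnDl mulnA leq_add2l leq_pmulr.
  have h2 : u <= u * (n * bitlen n) by rewrite leq_pmulr.
  by apply: leq_trans (leq_add h1 h2) _; rewrite -mulnDl leq_mul2r leq_addr orbT.
have [nl GE] := edge_list_graphE el.
(* For [c = 0] this needs the factor [c.+1], as words of [c] times a length would be empty. *)
have sw : KL * n < 2 ^ (c.+1 * (KL.+1 * bitlen n)).
  apply: leq_trans (mul_lt_exp2_bitlen _ _) _.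
  by rewrite leq_exp2l // leq_pmull.
have [||||fi [t [ht [G' [oG nG cG]]]]] :=
  streamer_correct (conf := conf) (fun lm => offline_run_sparse (hp n n0) n0)
    erefl n0 sw _ _ _ _ nl sp erefl (fun=> erefl).
- by rewrite /KL; nia.
- by rewrite /KL; nia.
- by rewrite /C; nia.
(* The successor of the quotient makes [n] times it dominate both [f n (g n)], in spite of rounding,
   and the linear overhead. *)
- have X1 : n <= n * (f n (g n) %/ n).+1 by rewrite leq_pmulr.
  have X2 : f n (g n) <= n * (f n (g n) %/ n).+1.
    by rewrite mulnC ltnW // ltn_ceil.
  by rewrite [leqRHS]mulnCA; exact: round_time_bound.
split=> //; exists t, G'; split=> //; last by rewrite GE.
by apply: leq_trans nG _; rewrite leq_mul2r leq_addl orbT.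
Qed.
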